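(* Let $\phi$ be a $\mathsf{CMSO}_2$-sentence and let $\mathcal{F}$ be the class of all graphs satisfying $\phi$. Suppose there exists a computable non-decreasing function $g\colon\mathbb{N}\to\mathbb{N}$ such that $\operatorname{tw}F\le g(\chi(F))$ for all $F\in\mathcal{F}$. Then $\textsc{HomInd}(\mathcal{F})$ is decidable.
   Context: $\mathsf{CMSO}_2$ is counting monadic second-order logic over graphs; $\operatorname{tw}$ denotes treewidth and $\chi$ chromatic number. $\hom(F,G)$ is the number of homomorphisms $F\to G$. For a fixed class $\mathcal{F}$, $\textsc{HomInd}(\mathcal{F})$ takes as input graphs $G,H$ and asks whether $\hom(F,G)=\hom(F,H)$ for all $F\in\mathcal{F}$. *)

(* Defs.v *)
From mathcomp Require Import all_boot.
From mathcomp Require Import boolp.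

Set Implicit Arguments.
Unset Strict Implicit.
Unset Printing Implicit Defensive.

Record sgraph := SGraph {
  vertex :> finType;
  adj : rel vertex;
  adj_sym : symmetric adj;
  adj_irr : irreflexive adj }.

Definition edges (G : sgraph) : {set {set G}} :=
  [set [set p.1; p.2] | p in [pred p : G * G | adj p.1 p.2]].

Definition is_hom (F G : sgraph) (f : {ffun F -> G}) : bool :=
  [forall x, forall y, adj x y ==> adj (f x) (f y)].

Definition hom (F G : sgraph) : nat := #|[set f : {ffun F -> G} | is_hom f]|.

Definition HomInd (C : sgraph -> Prop) (G H : sgraph) : Prop :=
  forall F : sgraph, C F -> hom F G = hom F H.

Definition colorable (F : sgraph) (k : nat) : bool :=
  [exists c : {ffun F -> 'I_k}, forall x, forall y, adj x y ==> (c x != c y)].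

Lemma colorable_card (F : sgraph) : exists k, colorable F k.
Proof.
exists #|F|; apply/existsP; exists [ffun x => enum_rank x].
apply/forallP=> x; apply/forallP=> y; apply/implyP=> xy; rewrite !ffunE.
by apply: contraTneq xy => /enum_rank_inj->; rewrite adj_irr.
Qed.

Definition chi (F : sgraph) : nat := ex_minn (colorable_card F).

Definition connected (G : sgraph) : Prop :=
  0 < #|G| /\ forall x y : G, connect (@adj G) x y.

(* A single edge, traversed back and forth, is a [ucycle] of size 2. *)
Definition acyclic (G : sgraph) : Prop :=
  forall c : seq G, ucycle (@adj G) c -> size c < 3.

Definition is_tree (T : sgraph) : Prop := connected T /\ acyclic T.

Record tree_decomposition (F T : sgraph) (bag : T -> {set F}) : Prop :=
  TreeDecomposition {
    td_tree : is_tree T;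
    td_vertex : forall v : F, exists t, v \in bag t;
    td_edge : forall u v : F, adj u v ->
      exists t, (u \in bag t) && (v \in bag t);
    td_connected : forall (v : F) (s t : T), v \in bag s -> v \in bag t ->
      connect [rel a b | [&& adj a b, v \in bag a & v \in bag b]] s t }.

(* The width of the empty bag is taken to be 0 rather than -1, so the graph
   without vertices has treewidth 0. *)
Definition width (F T : sgraph) (bag : T -> {set F}) : nat :=
  (\max_(t : T) #|bag t|).-1.

Definition has_width (F : sgraph) (k : nat) : Prop :=
  exists (T : sgraph) (bag : T -> {set F}),
    tree_decomposition bag /\ width bag = k.

Lemma has_width_card (F : sgraph) : exists k, `[< has_width F k >].
Proof.
pose T := @SGraph unit (fun _ _ => false) (fun _ _ => erefl) (fun _ => erefl).
pose bag (_ : T) := [set: F].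
exists (width bag); apply/asboolP; exists T, bag; split=> //; split.
- split; first by split=> [|[] []]; [rewrite card_unit | exact: connect0].
  by case=> [|x [|y s]] //=; rewrite /ucycle /= => /andP[].
- by move=> v; exists tt; rewrite inE.
- by move=> u v _; exists tt; rewrite !inE.
- by move=> v [] [] _ _; exact: connect0.
Qed.

Definition tw (F : sgraph) : nat := ex_minn (has_width_card F).

(* [cmso2 n m k l] is the type of formulas whose free variables are [n] vertex
   variables, [m] edge variables, [k] vertex set variables and [l] edge set
   variables, in de Bruijn style: a quantifier binds index 0 of its sort.
   Disjunction, universal quantification, adjacency and equality of sets are
   the usual abbreviations.  In the cardinality atoms, the type ['I_q] of the
   residue forces [0 < q]. *)
Inductive cmso2 : nat -> nat -> nat -> nat -> Type :=
| EqV n m k l (x y : 'I_n) : cmso2 n m k l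
| EqE n m k l (e f : 'I_m) : cmso2 n m k l
| Inc n m k l (x : 'I_n) (e : 'I_m) : cmso2 n m k l
| MemV n m k l (x : 'I_n) (X : 'I_k) : cmso2 n m k l
| MemE n m k l (e : 'I_m) (Y : 'I_l) : cmso2 n m k l
| CardV n m k l (X : 'I_k) (q : nat) (r : 'I_q) : cmso2 n m k l
| CardE n m k l (Y : 'I_l) (q : nat) (r : 'I_q) : cmso2 n m k l
| Not n m k l (a : cmso2 n m k l) : cmso2 n m k l
| And n m k l (a b : cmso2 n m k l) : cmso2 n m k l
| ExV n m k l (a : cmso2 n.+1 m k l) : cmso2 n m k l
| ExE n m k l (a : cmso2 n m.+1 k l) : cmso2 n m k l
| ExSetV n m k l (a : cmso2 n m k.+1 l) : cmso2 n m k l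
| ExSetE n m k l (a : cmso2 n m k l.+1) : cmso2 n m k l.

Definition cmso2_sentence : Type := cmso2 0 0 0 0.

Fixpoint sat (G : sgraph) n m k l (a : cmso2 n m k l) :
    n.-tuple G -> m.-tuple {set G} ->
    k.-tuple {set G} -> l.-tuple {set {set G}} -> bool :=
  match a with
  | EqV _ _ _ _ x y => fun v e V E => tnth v x == tnth v y
  | EqE _ _ _ _ x y => fun v e V E => tnth e x == tnth e y
  | Inc _ _ _ _ x y => fun v e V E => tnth v x \in tnth e y
  | MemV _ _ _ _ x X => fun v e V E => tnth v x \in tnth V X
  | MemE _ _ _ _ y Y => fun v e V E => tnth e y \in tnth E Y
  | CardV _ _ _ _ X q r => fun v e V E => #|tnth V X| %% q == r
  | CardE _ _ _ _ Y q r => fun v e V E => #|tnth E Y| %% q == r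
  | Not _ _ _ _ b => fun v e V E => ~~ sat b v e V E
  | And _ _ _ _ b c => fun v e V E => sat b v e V E && sat c v e V E
  | ExV _ _ _ _ b => fun v e V E =>
      [exists x : G, sat b [tuple of x :: v] e V E]
  | ExE _ _ _ _ b => fun v e V E =>
      [exists y in edges G, sat b v [tuple of y :: e] V E]
  | ExSetV _ _ _ _ b => fun v e V E =>
      [exists X : {set G}, sat b v e [tuple of X :: V] E]
  | ExSetE _ _ _ _ b => fun v e V E =>
      [exists Y : {set {set G}},
         (Y \subset edges G) && sat b v e V [tuple of Y :: E]]
  end.

Definition models (G : sgraph) (phi : cmso2_sentence) : bool :=
  @sat G 0 0 0 0 phi [tuple] [tuple] [tuple] [tuple].

Inductive recfun : Type :=
| Zero
| Succ
| Proj (i : nat)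
| Comp (f : recfun) (gs : seq recfun)
| Prec (f g : recfun)
| Mu (f : recfun).

(* [computes p v y]: on the arguments [v], the program [p] halts with value
   [y].  Programs carry no arity; an argument missing from [v] is read as 0. *)
Fixpoint computes (p : recfun) (v : seq nat) (y : nat) : Prop :=
  match p with
  | Zero => y = 0
  | Succ => y = (nth 0 v 0).+1
  | Proj i => y = nth 0 v i
  | Comp f gs =>
      exists ws : seq nat,
        (fix computes_all (gs : seq recfun) (ws : seq nat) : Prop :=
           match gs, ws with
           | [::], [::] => True
           | g :: gs', w :: ws' => computes g v w /\ computes_all gs' ws'
           | _, _ => False
           end) gs ws
        /\ computes f ws y
  | Prec f g =>
      exists s : nat -> nat,
        [/\ computes f (behead v) (s 0),
            forall i, i < nth 0 v 0 ->
              computes g [:: i, s i & behead v] (s i.+1)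
          & y = s (nth 0 v 0)]
  | Mu f =>
      computes f (y :: v) 0
      /\ forall i, i < y -> exists z, computes f (i :: v) z.+1
  end.

Lemma computes_functional (p : recfun) (v : seq nat) (y z : nat) :
  computes p v y -> computes p v z -> y = z.
Proof.
move: p v y z; fix IH 1 => -[||i|f gs|f g|f] v y z /=.
- by move=> -> ->.
- by move=> -> ->.
- by move=> -> ->.
- move=> [ws [Hws Hy]] [us [Hus Hz]].
  suff E : ws = us by apply: (IH f us) => //; rewrite -E.
  elim: gs ws us Hws Hus {Hy Hz} => [|g gs IHgs] [|w ws] [|u us] //=.
  by move=> [gw Hws] [gu Hus]; rewrite (IH g _ _ _ gw gu) (IHgs _ _ Hws Hus).
- move=> [s [s0 sS ->]] [t [t0 tS ->]].
  suff E i : i <= nth 0 v 0 -> s i = t i by exact: E.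
  elim: i => [_|i IHi lti]; first exact: (IH f _ _ _ s0 t0).
  apply: (IH g _ _ _ (sS i lti)); rewrite (IHi (ltnW lti)); exact: tS.
- move=> [y0 yP] [z0 zP]; case: (ltngtP y z) => // lt.
  + by have [w Hw] := zP _ lt; have := IH f _ _ _ y0 Hw.
  + by have [w Hw] := yP _ lt; have := IH f _ _ _ z0 Hw.
Qed.

Definition computable (g : nat -> nat) : Prop :=
  exists p : recfun, forall n, computes p [:: n] (g n).

(* The number of vertices followed by the adjacency matrix, row by row, coded
   as a single number by the bijection [CodeSeq.code : seq nat -> nat]. *)
Definition graph_code (G : sgraph) : nat :=
  CodeSeq.code
    (#|G| :: [seq nat_of_bool (adj x y) | x <- enum G, y <- enum G]).

Definition decidable_graph_rel (P : sgraph -> sgraph -> Prop) : Prop :=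
  exists p : recfun, forall G H : sgraph,
    (P G H -> computes p [:: graph_code G; graph_code H] 1)
    /\ (~ P G H -> computes p [:: graph_code G; graph_code H] 0).

(* Main.v *)
From HB Require Import structures.
From mathcomp Require Import all_boot all_algebra all_fingroup.
From mathcomp Require Import boolp zify.
Require Import Defs.

(* If hom(F,G) and hom(F,H) differ, then one of them is nonzero, so chi(F) is at
   most n = max(|G|,|H|) and tw(F) <= g(n).  Hence F is built from graphs on
   k = g(n) + 1 ports by gluing along ports and forgetting ports.  Each graph so
   built has a type from a finite set, which is compatible with gluing and
   determines whether the graph satisfies phi, and two vectors counting the
   homomorphisms into G and H that extend a given map of the ports.  Gluing acts
   bilinearly on the vectors, sorted by type, so the span of the vectors of the
   graphs built in at most h steps is stationary once h reaches the dimension of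
   the space.  A counterexample F therefore yields one whose size is bounded by a
   computable function of G and H, and a bounded search decides the problem. *)

Set Implicit Arguments.
Unset Strict Implicit.
Unset Printing Implicit Defensive.

(** * Closure properties of recursive functions *)

(** Types only bound the size of a counterexample: the search never computes the type of a graph,
    nor the table by which types combine. It is enough that such a table exists and that the number
    of types is a computable function of the number of ports. Sorting the vectors by type turns the
    difference of the two homomorphism counts, restricted to the models of [phi], into a linear
    functional; without it, a linear combination could mix models with non-models. Gluing and
    forgetting are merged into one binary operation [Node]: the first operand keeps all its ports,
    the second is glued along the ports in [S], and its other ports become inner vertices. A port
    may be absent from a graph, so all graphs live over the same [k] ports. Vertices and edges are
    both coded by pairs, vertices by diagonal ones. Vertex sets and edge sets thus become one kind
    of object, and a type needs a single clause for all four quantifiers. *)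

Definition rec m (f : seq nat -> nat) :=
  exists p, forall v, size v = m -> computes p v (f v).

Definition dec m (P : seq nat -> bool) := rec m (fun v => P v).

Lemma rec_ext m f g :
  (forall v, size v = m -> f v = g v) -> rec m f -> rec m g.
Proof. by move=> E [p Hp]; exists p => v sv; rewrite -E //; apply: Hp. Qed.

Lemma rec_nth m i : rec m (fun v => nth 0 v i).
Proof. by exists (Proj i). Qed.

Lemma rec_comp m f (gs : seq (seq nat -> nat)) :
  rec (size gs) f -> (forall i, i < size gs -> rec m (nth (fun=> 0) gs i)) ->
  rec m (fun v => f [seq g v | g <- gs]).
Proof.
move=> [pf Hf] Hgs.
have [ps [szps Hps]] : exists ps : seq recfun, size ps = size gs /\
    forall i v, i < size gs -> size v = m ->
      computes (nth Zero ps i) v (nth (fun=> 0) gs i v).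
  elim: gs Hgs {Hf} => [|g gs IH] Hgs; first by exists [::].
  have [p Hp] := Hgs 0 isT.
  have [ps [szps Hps]] := IH (fun i lti => Hgs i.+1 lti).
  exists (p :: ps); split=> [|[|i] v]; first by rewrite /= szps.
  - by move=> _; apply: Hp.
  - by move=> lti; apply: Hps.
exists (Comp pf ps) => v sv /=; exists [seq g v | g <- gs]; split; last first.
  by apply: Hf; rewrite size_map.
elim: ps gs szps Hps {Hf Hgs} => [|p ps IH] [|g gs] //= [szps] Hps.
split; first exact: (Hps 0 v isT sv).
by apply: IH => // i w lti; apply: (Hps i.+1).
Qed.

Lemma rec_app1 m (h : nat -> nat) f :
  rec 1 (fun v => h (nth 0 v 0)) -> rec m f -> rec m (fun v => h (f v)).
Proof. by move=> Hh Hf; apply: (rec_comp (gs := [:: f])) Hh _ => -[|[]]. Qed.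

Lemma rec_app2 m (h : nat -> nat -> nat) f g :
  rec 2 (fun v => h (nth 0 v 0) (nth 0 v 1)) -> rec m f -> rec m g ->
  rec m (fun v => h (f v) (g v)).
Proof.
move=> Hh Hf Hg.
by apply: (rec_comp (gs := [:: f; g])) Hh _ => -[|[|[]]].
Qed.

Lemma rec_succ m f : rec m f -> rec m (fun v => (f v).+1).
Proof. by apply: rec_app1; exists Succ. Qed.

Lemma rec_const m c : rec m (fun=> c).
Proof. by elim: c => [|c IH]; [exists Zero | apply: rec_succ IH]. Qed.

(** The list [s] selects, drops or repeats ambient arguments. This is the source of local
    definitions, of weakening and of the reordering needed for set quantifiers. *)
Lemma rec_args m n f (gs : seq (seq nat -> nat)) (s : seq nat) :
  rec n f -> size gs + size s = n ->
  (forall i, i < size gs -> rec m (nth (fun=> 0) gs i)) ->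
  rec m (fun v => f ([seq g v | g <- gs] ++ [seq nth 0 v i | i <- s])).
Proof.
move=> Hf En Hgs.
have := @rec_comp m f (gs ++ [seq (fun v => nth 0 v i) | i <- s]).
rewrite size_cat size_map En => /(_ Hf) H.
apply: rec_ext (H _) => [v _|i]; first by rewrite map_cat -map_comp.
move=> lti; rewrite nth_cat; case: (ltnP i (size gs)) => lei; first exact: Hgs.
by rewrite (nth_map 0) ?ltn_subLR ?En //; apply: rec_nth.
Qed.

Lemma map_nth_iota (v : seq nat) (a m : nat) :
  size v = a + m -> [seq nth 0 v i | i <- iota a m] = drop a v.
Proof.
move=> sv; apply: (@eq_from_nth _ 0) => [|i].
  by rewrite size_map size_iota size_drop sv addKn.
rewrite size_map size_iota => lti.
by rewrite (nth_map 0) ?size_iota // nth_iota // nth_drop.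
Qed.

Lemma rec_let m F f :
  rec m f -> rec m.+1 (fun w => F (nth 0 w 0) (behead w)) ->
  rec m (fun v => F (f v) v).
Proof.
move=> Hf HF.
apply: rec_ext (rec_args (gs := [:: f]) (s := iota 0 m) HF _ _) => [v sv||].
- by rewrite map_nth_iota // drop0.
- by rewrite size_iota.
- by case.
Qed.

Lemma rec_behead m f : rec m f -> rec m.+1 (fun w => f (behead w)).
Proof.
move=> Hf.
apply: rec_ext (rec_args (gs := [::]) (s := iota 1 m) Hf _ _) => [v sv||//].
  by rewrite map_nth_iota // drop1.
by rewrite size_iota.
Qed.

(** A step of [Prec] receives the counter and the accumulated value; this discards the latter for
    functions of the counter alone. *)
Lemma rec_skip1 m F :
  rec m.+1 (fun w => F (nth 0 w 0) (behead w)) ->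
  rec m.+2 (fun w => F (nth 0 w 0) (behead (behead w))).
Proof.
move=> HF.
apply: rec_ext (rec_args (gs := [::]) (s := 0 :: iota 2 m) HF _ _) => [v sv||//].
  by rewrite /= map_nth_iota //; case: v sv => [|a [|b v]] //= _; rewrite drop0.
by rewrite /= size_iota.
Qed.

Lemma rec_prim m b f0 (F : nat -> nat -> seq nat -> nat) :
  rec m b -> rec m f0 ->
  rec m.+2 (fun w => F (nth 0 w 0) (nth 0 w 1) (behead (behead w))) ->
  rec m (fun v => nat_rect (fun=> nat) (f0 v) (fun i s => F i s v) (b v)).
Proof.
move=> Hb [p0 H0] [pF HF].
(* [Prec] recurses on its first argument, so the bound is first moved to that position. *)
apply: (@rec_let m (fun c v => nat_rect _ (f0 v) (fun i s => F i s v) c)) => //.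
exists (Prec p0 pF) => w sw /=.
have sbw : size (behead w) = m by rewrite size_behead sw.
exists (nat_rect _ (f0 (behead w)) (fun i s => F i s (behead w))).
split=> // [|i lti]; first exact: H0.
by apply: (HF [:: i, _ & behead w]); rewrite /= sbw.
Qed.

Lemma rec_add m f g : rec m f -> rec m g -> rec m (fun v => f v + g v).
Proof.
apply: rec_app2; apply: (@rec_ext 2
  (fun v => nat_rect (fun=> nat) (nth 0 v 0) (fun i s => s.+1) (nth 0 v 1))).
  by move=> v _; elim: (nth 0 v 1) => [|c IH] /=; rewrite ?addn0 // IH addnS.
by apply: (rec_prim (F := fun i s v => s.+1));
  try apply: rec_succ; apply: rec_nth.
Qed.

Lemma rec_bigsum m b (F : nat -> seq nat -> nat) :
  rec m b -> rec m.+1 (fun w => F (nth 0 w 0) (behead w)) ->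
  rec m (fun v => \sum_(i < b v) F i v).
Proof.
move=> Hb HF; apply: (@rec_ext m
  (fun v => nat_rect (fun=> nat) 0 (fun i s => s + F i v) (b v))) => [v sv|].
  by elim: (b v) => [|c IH]; rewrite ?big_ord0 // big_ord_recr /= IH.
apply: (@rec_prim m b (fun=> 0) (fun i s v => s + F i v)) => //.
  exact: rec_const.
by apply: rec_add; [apply: rec_nth|apply: rec_skip1].
Qed.

Lemma rec_mul m f g : rec m f -> rec m g -> rec m (fun v => f v * g v).
Proof.
move=> Hf Hg; apply: (@rec_ext m (fun v => \sum_(i < f v) g v)) => [v _|].
  by rewrite sum_nat_const card_ord.
exact: (rec_bigsum (F := fun _ v => g v) Hf (rec_behead Hg)).
Qed.

Lemma rec_exp m f g : rec m f -> rec m g -> rec m (fun v => f v ^ g v).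
Proof.
move=> Hf Hg; apply: (@rec_ext m
  (fun v => nat_rect (fun=> nat) 1 (fun i s => f v * s) (g v))) => [v _|].
  by elim: (g v) => [|c IH] //=; rewrite IH expnS.
apply: (rec_prim (F := fun i s v => f v * s)) => //; first exact: rec_const.
by apply: rec_mul; [exact: rec_behead (rec_behead Hf) | apply: rec_nth].
Qed.

Lemma rec_pred m f : rec m f -> rec m (fun v => (f v).-1).
Proof.
apply: rec_app1; apply: (@rec_ext 1
  (fun v => nat_rect (fun=> nat) 0 (fun i s => i) (nth 0 v 0))) => [v _|].
  by case: (nth 0 v 0).
by apply: (rec_prim (F := fun i s v => i)); [|apply: rec_const|];
  apply: rec_nth.
Qed.

Lemma rec_sub m f g : rec m f -> rec m g -> rec m (fun v => f v - g v).
Proof.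
apply: rec_app2; apply: (@rec_ext 2
  (fun v => nat_rect (fun=> nat) (nth 0 v 0) (fun i s => s.-1) (nth 0 v 1))).
  by move=> v _; elim: (nth 0 v 1) => [|c IH] /=; rewrite ?subn0 // IH subnS.
by apply: (rec_prim (F := fun i s v => s.-1));
  try apply: rec_pred; apply: rec_nth.
Qed.

Lemma rec_nat_eq0 m f : rec m f -> dec m (fun v => f v == 0).
Proof.
move=> Hf; apply: (@rec_ext m (fun v => 1 - f v)) => [v _|].
  by case: (f v).
by apply: rec_sub => //; apply: rec_const.
Qed.

Lemma dec_neg m P : dec m P -> dec m (fun v => ~~ P v).
Proof. by move/rec_nat_eq0; apply: rec_ext => v _; case: (P v). Qed.

Lemma dec_and m P Q : dec m P -> dec m Q -> dec m (fun v => P v && Q v).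
Proof. by move=> HP /(rec_mul HP); apply: rec_ext => v _; rewrite mulnb. Qed.

Lemma dec_or m P Q : dec m P -> dec m Q -> dec m (fun v => P v || Q v).
Proof.
move=> /dec_neg HP /dec_neg /(dec_and HP)/dec_neg.
by apply: rec_ext => v _; rewrite negb_and !negbK.
Qed.

Lemma dec_imp m P Q : dec m P -> dec m Q -> dec m (fun v => P v ==> Q v).
Proof.
by move=> /dec_neg/dec_or H /H; apply: rec_ext => v _; rewrite implybE.
Qed.

Lemma dec_leq m f g : rec m f -> rec m g -> dec m (fun v => f v <= g v).
Proof. by move=> Hf Hg; apply: rec_nat_eq0; apply: rec_sub. Qed.

Lemma dec_ltn m f g : rec m f -> rec m g -> dec m (fun v => f v < g v).
Proof. by move=> Hf Hg; apply: dec_leq => //; apply: rec_succ. Qed.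

Lemma dec_eq m f g : rec m f -> rec m g -> dec m (fun v => f v == g v).
Proof.
move=> Hf Hg; apply: rec_ext (dec_and (dec_leq Hf Hg) (dec_leq Hg Hf)) => v _.
by rewrite eqn_leq.
Qed.

Lemma dec_exists m b (P : nat -> seq nat -> bool) :
  rec m b -> dec m.+1 (fun w => P (nth 0 w 0) (behead w)) ->
  dec m (fun v => [exists i : 'I_(b v), P i v]).
Proof.
move=> Hb HP; apply: rec_ext (dec_neg (rec_nat_eq0
  (rec_bigsum (F := fun i v => P i v) Hb HP))) => v _ /=.
rewrite sum_nat_eq0 negb_forall; congr nat_of_bool.
by apply: eq_existsb => i; rewrite /= eqb0 negbK.
Qed.

Lemma dec_forall m b (P : nat -> seq nat -> bool) :
  rec m b -> dec m.+1 (fun w => P (nth 0 w 0) (behead w)) ->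
  dec m (fun v => [forall i : 'I_(b v), P i v]).
Proof.
move=> Hb HP; apply: rec_ext (dec_neg (dec_exists Hb
  (P := fun i v => ~~ P i v) (dec_neg HP))) => v _ /=.
by rewrite negb_exists; congr nat_of_bool; apply: eq_forallb => i; rewrite negbK.
Qed.

Lemma rec_if m P f g :
  dec m P -> rec m f -> rec m g -> rec m (fun v => if P v then f v else g v).
Proof.
move=> HP Hf Hg; apply: rec_ext (rec_add (rec_mul HP Hf)
  (rec_mul (dec_neg HP) Hg)) => v _.
by case: (P v); rewrite /= !(mul0n, mul1n, addn0).
Qed.

Lemma rec_max m f g : rec m f -> rec m g -> rec m (fun v => maxn (f v) (g v)).
Proof. by move=> Hf Hg; apply: rec_if => //; apply: dec_ltn. Qed.

Lemma rec_min m f g : rec m f -> rec m g -> rec m (fun v => minn (f v) (g v)).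
Proof. by move=> Hf Hg; apply: rec_if => //; apply: dec_ltn. Qed.

Lemma sum_ltn n c : n <= c -> \sum_(i < c) (i < n) = n.
Proof.
move=> le; rewrite -big_mkcond /= sum1_card -[RHS]card_ord.
rewrite -(card_image (f := widen_ord le)) => [|i j /(congr1 val)/= E].
  apply: eq_card => i; apply/idP/imageP => [lti|[j _ ->]].
    by exists (Ordinal lti) => //; apply: val_inj.
  exact: (ltn_ord j).
exact: val_inj.
Qed.

(** The quotient of [a] by [d] counts the positive multiples of [d] up to [a]. It is at most [a], so
    [a] candidates suffice; division by zero must return 0, as [divn] does. *)
Lemma rec_div m f g : rec m f -> rec m g -> rec m (fun v => f v %/ g v).
Proof.
apply: rec_app2.
apply: (@rec_ext 2 (fun v => if nth 0 v 1 == 0 then 0 else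
   \sum_(i < nth 0 v 0) (i.+1 * nth 0 v 1 <= nth 0 v 0))) => [v _|].
  case: eqP => [->|/eqP]; first by rewrite divn0.
  rewrite -lt0n => d0; set a := nth 0 v 0; set d := nth 0 v 1 in d0 *.
  rewrite (eq_bigr (fun i : 'I_a => nat_of_bool (i < a %/ d))) => [|i _].
    by rewrite sum_ltn // leq_div.
  by rewrite leq_divRL.
apply: rec_if; first by apply: rec_nat_eq0; apply: rec_nth.
  exact: rec_const.
apply: (rec_bigsum (F := fun i v => i.+1 * nth 0 v 1 <= nth 0 v 0)).
  exact: rec_nth.
apply: dec_leq; last exact: rec_behead (rec_nth _ _).
apply: rec_mul; last exact: rec_behead (rec_nth _ _).
exact: rec_succ (rec_nth _ _).
Qed.

Lemma rec_mod m f g : rec m f -> rec m g -> rec m (fun v => f v %% g v).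
Proof.
move=> Hf Hg; apply: rec_ext (rec_sub Hf (rec_mul (rec_div Hf Hg) Hg)) => v _.
by rewrite {1}(divn_eq (f v) (g v)) addKn.
Qed.

Lemma rec_iter m (h : nat -> nat) b f :
  rec 1 (fun v => h (nth 0 v 0)) -> rec m b -> rec m f ->
  rec m (fun v => iter (b v) h (f v)).
Proof.
move=> Hh Hb Hf; apply: (@rec_ext m
  (fun v => nat_rect (fun=> nat) (f v) (fun i s => h s) (b v))) => [v _|].
  by elim: (b v) => //= c ->.
by apply: (rec_prim (F := fun _ s _ => h s)) => //;
  apply: (rec_app1 Hh); apply: rec_nth.
Qed.

(** * Monadic second-order logic with a single sort of sets *)

(** All atoms of the logic reduce to counting such pairs: emptiness of [LOff X] makes [X] a vertex
    set, that of [LDiag X] an edge set, that of [LDiff X Y] an inclusion, and non-emptiness of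
    [LInc X Y] is incidence. *)
Inductive lpred D :=
  | LMem (X : 'I_D)
  | LDiff (X Y : 'I_D)
  | LInc (X Y : 'I_D)
  | LDiag (X : 'I_D)
  | LOff (X : 'I_D).

Inductive form D :=
  | FCnt (l : lpred D) (b : bool) (q r : nat)
  | FNot (f : form D)
  | FAnd (f g : form D)
  | FEx (x : 'I_D) (f : form D).

Definition lholds D (V : eqType) (l : lpred D) (e : 'I_D -> pred (V * V))
    (p : V * V) : bool :=
  match l with
  | LMem X => e X p
  | LDiff X Y => e X p && ~~ e Y p
  | LInc X Y => e Y p && (e X (p.1, p.1) || e X (p.2, p.2))
  | LDiag X => e X p && (p.1 == p.2)
  | LOff X => e X p && (p.1 != p.2)
  end.

(** Two finite views of a number through which addition factors: residues, for the counting atoms,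
    and values truncated at a threshold, for emptiness and for being a singleton. *)
Definition summary (b : bool) q n := if b then n %% q.+1 else minn n q.

Lemma summary_add b q m n m' n' :
  summary b q m = summary b q m' -> summary b q n = summary b q n' ->
  summary b q (m + n) = summary b q (m' + n').
Proof.
case: b => /= [E1 E2|]; first by rewrite -modnDm E1 E2 modnDm.
rewrite /minn; do ![case: ltnP => ?]; lia.
Qed.

Lemma summary_lt b q n : summary b q n < q.+1.
Proof. by case: b; [rewrite ltn_pmod | rewrite ltnS geq_minr]. Qed.

Definition upd D (T : finType) (e : {ffun 'I_D -> {set T}}) x Y :
  {ffun 'I_D -> {set T}} := [ffun y => if y == x then Y else e y].

Section Satisfaction.
Variables (D : nat) (V : finType) (R : {set V * V}).
Implicit Type e : {ffun 'I_D -> {set V * V}}.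

Definition lset (l : lpred D) e : {set V * V} :=
  [set p in R | lholds l (fun X => mem (e X)) p].

Fixpoint fsat (f : form D) e : bool :=
  match f with
  | FCnt l b q r => summary b q #|lset l e| == r
  | FNot f => ~~ fsat f e
  | FAnd f g => fsat f e && fsat g e
  | FEx x f => [exists Y : {set V * V}, (Y \subset R) && fsat f (upd e x Y)]
  end.

Definition fnone (l : lpred D) := FCnt l false 1 0.

Lemma fsat_none l e : fsat (fnone l) e = (lset l e == set0).
Proof. by rewrite /= -cards_eq0 /minn; case: ltnP; case: #|_| => [|[]]. Qed.

End Satisfaction.

Fixpoint qdepth n m k l (a : cmso2 n m k l) : nat :=
  match a with
  | Not _ _ _ _ b => qdepth b
  | And _ _ _ _ b c => maxn (qdepth b) (qdepth c)
  | ExV _ _ _ _ b => (qdepth b).+1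
  | ExE _ _ _ _ b => (qdepth b).+1
  | ExSetV _ _ _ _ b => (qdepth b).+1
  | ExSetE _ _ _ _ b => (qdepth b).+1
  | _ => 0
  end.

(** Slot [d] of the environment holds the variable bound at quantifier depth [d]; the four lists
    send the de Bruijn indices of each sort to slots. An individual variable becomes a singleton,
    recognised by a count truncated at 2 that equals 1. The modulus is shifted because [summary]
    reduces modulo the successor of its parameter. *)
Fixpoint trans D n m k l (a : cmso2 n m k l) (d : nat) (v e V E : seq nat) :
    form D.+1 :=
  let var s i := inord (nth 0 s i) in
  let ex c (b : form D.+1) :=
    FEx (inord d) (FAnd (fnone (c (inord d))) b) in
  let one b := FAnd (FCnt (LMem (inord d)) false 2 1) b in
  match a with
  | EqV _ _ _ _ x y => fnone (LDiff (var v x) (var v y))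
  | EqE _ _ _ _ x y => fnone (LDiff (var e x) (var e y))
  | Inc _ _ _ _ x y => FNot (fnone (LInc (var v x) (var e y)))
  | MemV _ _ _ _ x X => fnone (LDiff (var v x) (var V X))
  | MemE _ _ _ _ y Y => fnone (LDiff (var e y) (var E Y))
  | CardV _ _ _ _ X q r => FCnt (LMem (var V X)) true q.-1 r
  | CardE _ _ _ _ Y q r => FCnt (LMem (var E Y)) true q.-1 r
  | Not _ _ _ _ b => FNot (trans D b d v e V E)
  | And _ _ _ _ b c => FAnd (trans D b d v e V E) (trans D c d v e V E)
  | ExV _ _ _ _ b => ex (@LOff _) (one (trans D b d.+1 (d :: v) e V E))
  | ExE _ _ _ _ b => ex (@LDiag _) (one (trans D b d.+1 v (d :: e) V E))
  | ExSetV _ _ _ _ b => ex (@LOff _) (trans D b d.+1 v e (d :: V) E)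
  | ExSetE _ _ _ _ b => ex (@LDiag _) (trans D b d.+1 v e V (d :: E))
  end.

(* [R] contains a diagonal pair for every vertex of [F] and one orientation of
   every edge of [F], through the injection [f]; the elements of [V] outside
   the image of [f] are absent from the graph. *)
Record represents (F : sgraph) (V : finType) (R : {set V * V}) (f : F -> V) :=
  Represents {
    rep_inj : injective f;
    rep_codom : forall p, p \in R -> exists x y, p = (f x, f y);
    rep_adj : forall x y,
      ((f x, f y) \in R) || ((f y, f x) \in R) = (x == y) || adj x y;
    rep_anti : forall x y, (f x, f y) \in R -> (f y, f x) \in R -> x = y }.

Section Transfer.
Variables (F : sgraph) (V : finType) (R : {set V * V}) (f : F -> V).
Hypothesis rep : represents R f.

Let finj := rep_inj rep.

Lemma rep_diag x : (f x, f x) \in R.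
Proof. by have := rep_adj rep x x; rewrite eqxx orbb. Qed.

Lemma rep_edge x y : x != y -> (f x, f y) \in R -> adj x y.
Proof. by move=> /negPf xy H; have := rep_adj rep x y; rewrite H xy. Qed.

Lemma edgesP (z : {set F}) :
  reflect (exists x y, adj x y /\ z = [set x; y]) (z \in edges F).
Proof.
apply: (iffP imsetP) => [[[x y]]|[x [y [xy ->]]]]; last by exists (x, y).
by rewrite inE /= => xy ->; exists x, y.
Qed.

Lemma mem_edges x y : ([set x; y] \in edges F) = adj x y.
Proof.
apply/edgesP/idP => [[a [b [ab E]]]|xy]; last by exists x, y.
have /set2P[xE|xE] : x \in [set a; b] by rewrite -E set21.
  subst a; have /set2P[yE|->//] : y \in [set x; b] by rewrite -E set22.
  subst y; have : b \in [set x; x] by rewrite E set22.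
  by rewrite !inE orbb => /eqP bx; rewrite bx adj_irr in ab.
subst b; have /set2P[->|yE] : y \in [set a; x] by rewrite -E set22.
  by rewrite adj_sym.
subst y; have : a \in [set x; x] by rewrite E set21.
by rewrite !inE orbb => /eqP bx; rewrite bx adj_irr in ab.
Qed.

Definition encV (X : {set F}) : {set V * V} := [set (f x, f x) | x in X].

Definition encE (Z : {set {set F}}) : {set V * V} :=
  [set (f p.1, f p.2) | p in
     [pred p : F * F | ((f p.1, f p.2) \in R) && ([set p.1; p.2] \in Z)]].

Lemma encVP X x y : ((f x, f y) \in encV X) = (x == y) && (x \in X).
Proof.
apply/imsetP/andP => [[z zX [/finj-> /finj->]]|[/eqP<- xX]].
  by rewrite eqxx.
by exists x.
Qed.

Lemma encEP Z x y :
  ((f x, f y) \in encE Z) = ((f x, f y) \in R) && ([set x; y] \in Z).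
Proof.
apply/imsetP/idP => [[[a b]]|H]; last by exists (x, y).
by rewrite inE => H [/finj-> /finj->].
Qed.

Lemma encV_sub X : encV X \subset R.
Proof. by apply/subsetP=> _ /imsetP[x _ ->]; apply: rep_diag. Qed.

Lemma encE_sub Z : encE Z \subset R.
Proof. by apply/subsetP=> _ /imsetP[[x y] /andP[H _] ->]. Qed.

Lemma repP (A B : {set V * V}) : A \subset R -> B \subset R ->
  (forall x y, ((f x, f y) \in A) = ((f x, f y) \in B)) -> A = B.
Proof.
move=> /subsetP AR /subsetP BR E; apply/setP=> p.
have [pR|pR] := boolP (p \in R).
  by have [x [y ->]] := rep_codom rep pR.
by rewrite (contraNF (AR p) pR) (contraNF (BR p) pR).
Qed.

Lemma encV_diag (X : {set F}) p : p \in encV X -> p.1 == p.2.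
Proof. by case/imsetP=> x _ ->. Qed.

Lemma encE_off (Z : {set {set F}}) p : Z \subset edges F -> p \in encE Z -> p.1 != p.2.
Proof.
move=> /subsetP ZE /imsetP[[x y] /andP[_ /ZE]]; rewrite mem_edges => xy -> /=.
by apply: contraTneq xy => /finj->; rewrite adj_irr.
Qed.

Lemma encV_onto (Y : {set V * V}) : Y \subset R ->
  (forall p, p \in Y -> p.1 == p.2) -> Y = encV [set x | (f x, f x) \in Y].
Proof.
move=> YR Yd; apply: repP => // [|x y]; first exact: encV_sub.
rewrite encVP inE; apply/idP/andP => [H|[/eqP<-]] //.
by have /= /eqP/finj xy := Yd _ H; rewrite xy in H *; rewrite eqxx H.
Qed.

Lemma encE_onto (Y : {set V * V}) : Y \subset R ->
  (forall p, p \in Y -> p.1 != p.2) ->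
  exists2 Z : {set {set F}}, Z \subset edges F & Y = encE Z.
Proof.
move=> YR Yd; have YR' := subsetP YR.
exists [set [set p.1; p.2] | p in [pred p : F * F | (f p.1, f p.2) \in Y]].
  apply/subsetP => _ /imsetP[[x y] H ->]; rewrite mem_edges.
  apply: rep_edge; last exact: YR'.
  by apply: contraNneq (Yd _ H) => /= ->.
apply: repP => // [|x y]; first exact: encE_sub.
rewrite encEP; apply/idP/andP => [H|[xyR /imsetP[[a b] abY /= E]]].
  by split; [apply: YR' | apply/imsetP; exists (x, y)].
rewrite inE /= in abY; have abR := YR' _ abY.
have /set2P[xE|xE] : x \in [set a; b] by rewrite -E set21.
  subst a; have /set2P[yE|->//] : y \in [set x; b] by rewrite -E set22.
  have : b \in [set x; y] by rewrite E set22.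
  by rewrite yE !inE orbb => /eqP bx; rewrite bx in abY *.
subst b; have /set2P[yE|yE] : y \in [set a; x] by rewrite -E set22.
  by subst y; rewrite (rep_anti rep abR xyR) in abY *.
have : a \in [set x; y] by rewrite E set21.
by rewrite yE !inE orbb => /eqP bx; rewrite bx in abY *.
Qed.

Lemma card_encV X : #|encV X| = #|X|.
Proof. by rewrite card_imset // => x y [/finj]. Qed.

(** Forgetting orientations is injective on a coded edge set because [R] never contains both
    orientations of an edge. This is why a symmetric coding would not do for the counting atoms. *)
Lemma card_encE (Z : {set {set F}}) : Z \subset edges F -> #|encE Z| = #|Z|.
Proof.
move=> /subsetP ZE; pose un (p : V * V) := [set p.1; p.2].
have inj_un : {in encE Z &, injective un}.
  move=> _ _ /imsetP[[x y] /andP[xy _] ->] /imsetP[[a b] /andP[ab _] ->].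
  rewrite /un /= => E; rewrite /= in xy ab.
  have /set2P[/finj xE|/finj xE] : f x \in [set f a; f b] by rewrite -E set21.
    subst a; have /set2P[/finj yE|/finj->//] : f y \in [set f x; f b].
      by rewrite -E set22.
    subst y; have : f b \in [set f x; f x] by rewrite E set22.
    by rewrite !inE orbb => /eqP/finj->.
  subst b; have /set2P[/finj yE|/finj yE] : f y \in [set f a; f x].
      by rewrite -E set22.
    by subst y; rewrite (rep_anti rep xy ab).
  subst y; have : f a \in [set f x; f x] by rewrite E set21.
  by rewrite !inE orbb => /eqP/finj->.
rewrite -(card_in_imset inj_un) -(card_imset _ (imset_inj finj)).
apply: eq_card => z; apply/imsetP/imsetP => -[].
  move=> _ /imsetP[[x y] /andP[_ /= H] ->] ->; exists [set x; y] => //.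
  by rewrite imsetU1 imset_set1.
move=> y yZ ->; have /edgesP[a [b [ab yE]]] := ZE _ yZ.
have := rep_adj rep a b; rewrite ab orbT => /orP[H|H].
  exists (f a, f b); last by rewrite yE imsetU1 imset_set1.
  by rewrite encEP H -yE.
exists (f b, f a); last by rewrite yE imsetU1 imset_set1 /un /= setUC.
by rewrite encEP H setUC -yE.
Qed.

Lemma encE_subset (Z Z' : {set {set F}}) : Z \subset edges F ->
  (encE Z \subset encE Z') = (Z \subset Z').
Proof.
move=> /subsetP ZE; apply/subsetP/subsetP => H z; last first.
  case/imsetP=> -[x y] /andP[xyR xyZ] ->; rewrite encEP xyR; exact: H.
move=> zZ; have /edgesP[a [b [ab zE]]] := ZE _ zZ.
have := rep_adj rep a b; rewrite ab orbT => /orP[Hab|Hab].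
  have := H (f a, f b); rewrite !encEP Hab -zE; exact.
have := H (f b, f a); rewrite !encEP Hab [[set b; a]]setUC -zE; exact.
Qed.

Variable D : nat.
Implicit Type env : {ffun 'I_D.+1 -> {set V * V}}.

Lemma lset_diff env (X Y : 'I_D.+1) : env X \subset R ->
  fsat R (fnone (LDiff X Y)) env = (env X \subset env Y).
Proof.
move=> XR; rewrite fsat_none -setD_eq0; congr (_ == _); apply/setP=> p.
rewrite !inE /= andbC; case: (p \in env Y); rewrite ?andbF //= andbT.
by case: (boolP (p \in env X)) => // /(subsetP XR)->.
Qed.

Lemma lset_mem env (X : 'I_D.+1) : env X \subset R -> lset R (LMem X) env = env X.
Proof.
move=> XR; apply/setP=> p; rewrite !inE /=.
by case: (boolP (p \in env X)) => [/(subsetP XR)->|] //; rewrite andbF.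
Qed.

Lemma fsat_off env (X : 'I_D.+1) : env X \subset R ->
  reflect (forall p, p \in env X -> p.1 == p.2) (fsat R (fnone (LOff X)) env).
Proof.
move=> XR; rewrite fsat_none; apply: (iffP eqP) => [E p pX|H].
  apply: contraTT isT => ne; have : p \in (set0 : {set V * V}).
    by rewrite -E inE (subsetP XR) //=; apply/andP; split.
  by rewrite inE.
by apply/setP=> p; rewrite !inE /=; apply: contraTF isT => /and3P[_ /H->].
Qed.

Lemma fsat_diag env (X : 'I_D.+1) : env X \subset R ->
  reflect (forall p, p \in env X -> p.1 != p.2) (fsat R (fnone (LDiag X)) env).
Proof.
move=> XR; rewrite fsat_none; apply: (iffP eqP) => [E p pX|H].
  apply: contraTT isT; rewrite negbK => ne; have : p \in (set0 : {set V * V}).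
    by rewrite -E inE (subsetP XR) //=; apply/andP; split.
  by rewrite inE.
by apply/setP=> p; rewrite !inE /=; apply: contraTF isT => /and3P[_ /H/negPf->].
Qed.

Lemma fsat_inc env (X Y : 'I_D.+1) x z : z \in edges F ->
  env X = encV [set x] -> env Y = encE [set z] ->
  fsat R (fnone (LInc X Y)) env = (x \notin z).
Proof.
move=> /edgesP[a [b [ab ->]]] EX EY; rewrite fsat_none.
have inc u w : lholds (LInc X Y) (fun X => mem (env X)) (f u, f w) =
    ((f u, f w) \in encE [set [set a; b]]) && ((x == u) || (x == w)).
  have H y : mem (env X) (f y, f y) = (x == y).
    by rewrite EX [LHS]encVP eqxx inE eq_sym.
  by rewrite -(H u) -(H w) -EY.
apply/eqP/idP => [E|xab].
  have no u w : (f u, f w) \in encE [set [set a; b]] ->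
      ~~ ((x == u) || (x == w)).
    move=> H; have : (f u, f w) \notin lset R (LInc X Y) env.
      by rewrite E inE.
    by rewrite !inE inc H (subsetP (encE_sub _) _ H).
  have := rep_adj rep a b; rewrite ab orbT !inE => /orP[H|H].
    by apply: no; rewrite encEP H set11.
  by rewrite orbC; apply: no; rewrite encEP H setUC set11.
apply: repP; rewrite ?sub0set //; first by apply/subsetP=> p; rewrite inE => /andP[].
move=> u w; rewrite !inE inc encEP; apply: contraNF xab.
by move=> /and3P[_ /andP[_ /set1P<-]]; rewrite !inE.
Qed.

(** The free variables sit in slots below [d], so a quantifier that writes slot [d] leaves them
    intact; the bound on [qdepth] keeps [d] among the [D.+1] slots. *)
Lemma transfer n m k l (a : cmso2 n m k l) d (sv se sV sE : seq nat)
    (v : n.-tuple F) (e : m.-tuple {set F}) (W : k.-tuple {set F})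
    (E : l.-tuple {set {set F}}) env :
  d + qdepth a <= D.+1 ->
  (forall i : 'I_n, nth 0 sv i < d /\
    env (inord (nth 0 sv i)) = encV [set tnth v i]) ->
  (forall i : 'I_m, nth 0 se i < d /\ tnth e i \in edges F /\
    env (inord (nth 0 se i)) = encE [set tnth e i]) ->
  (forall i : 'I_k, nth 0 sV i < d /\
    env (inord (nth 0 sV i)) = encV (tnth W i)) ->
  (forall i : 'I_l, nth 0 sE i < d /\ tnth E i \subset edges F /\
    env (inord (nth 0 sE i)) = encE (tnth E i)) ->
  fsat R (trans D a d sv se sV sE) env = sat a v e W E.
Proof.
elim: a d sv se sV sE v e W E env => {n m k l}
  [n m k l x y|n m k l x y|n m k l x y|n m k l x X|n m k l y Y
  |n m k l X q r|n m k l Y q r|n m k l b IH|n m k l b IHb c IHc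
  |n m k l b IH|n m k l b IH|n m k l b IH|n m k l b IH]
  d sv se sV sE v e W E env dD Hv He HV HE.
- have [_ Ex] := Hv x; have [_ Ey] := Hv y.
  rewrite [LHS]lset_diff ?Ex ?encV_sub // Ey; apply/subsetP/eqP => [|->] //.
  by move=> /(_ (f (tnth v x), f (tnth v x))); rewrite !encVP !inE !eqxx /= => /(_ isT)/eqP.
- have [_ [xE Ex]] := He x; have [_ [yE Ey]] := He y.
  rewrite [LHS]lset_diff ?Ex ?encE_sub // Ey encE_subset ?sub1set //.
  by rewrite inE.
- have [_ Ex] := Hv x; have [_ [yE Ey]] := He y.
  by have /(congr1 negb) := fsat_inc yE Ex Ey; rewrite negbK.
- have [_ Ex] := Hv x; have [_ EX] := HV X.
  rewrite [LHS]lset_diff ?Ex ?encV_sub // EX; apply/subsetP/idP => [|xX p].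
    by move=> /(_ (f (tnth v x), f (tnth v x))); rewrite !encVP !inE !eqxx /= => /(_ isT).
  by move=> /imsetP[_ /set1P-> ->]; rewrite encVP eqxx.
- have [_ [yE Ey]] := He y; have [_ [YE EY]] := HE Y.
  by rewrite [LHS]lset_diff ?Ey ?encE_sub // EY encE_subset ?sub1set.
- have [_ EX] := HV X; rewrite /= lset_mem EX ?encV_sub // card_encV.
  by case: q r {dD} => [[]|q] //=.
- have [_ [YE EY]] := HE Y; rewrite /= lset_mem EY ?encE_sub // card_encE //.
  by case: q r {dD} => [[]|q] //=.
- by rewrite /= (IH _ _ _ _ _ v e W E).
- move: dD; rewrite /= addn_maxr geq_max => /andP[db dc].
  by rewrite (IHb _ _ _ _ _ v e W E) // (IHc _ _ _ _ _ v e W E).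
all: have dd : d < D.+1 by apply: leq_trans dD; rewrite /= addnS ltnS leq_addr.
all: move: dD; rewrite /= addnS -addSn => dD.
all: have inordd i : i < d ->
  ((inord i : 'I_D.+1) == inord d) = false
  by move=> lti; apply/negP=> /eqP/(congr1 val) /=;
     rewrite !inordK ?(ltn_trans lti dd) //; lia.
all: have updd Y i : i < d -> upd env (inord d) Y (inord i) = env (inord i)
  by move=> lti; rewrite ffunE inordd.
all: have updx Y : upd env (inord d) Y (inord d) = Y by rewrite ffunE eqxx.
- pose okX x := upd env (inord d) (encV [set x]).
  have IHx x : fsat R (trans D b d.+1 (d :: sv) se sV sE) (okX x) =
      sat b [tuple of x :: v] e W E.
    apply: IH => // i.
    + case: (unliftP ord0 i) => [j ->|->]; last by rewrite /= updx tnth0.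
      by have [lt Ej] := Hv j; rewrite tnthS /= updd //; split=> //; apply: leqW.
    + by have [lt [? Ej]] := He i; rewrite updd //; split=> //; apply: leqW.
    + by have [lt Ej] := HV i; rewrite updd //; split=> //; apply: leqW.
    + by have [lt [? Ej]] := HE i; rewrite updd //; split=> //; apply: leqW.
  apply/existsP/existsP => [[Y /and4P[YR Yd]]|[x Hx]].
    rewrite /= lset_mem ?updx // => Y1.
    have {}Yd : forall p, p \in Y -> p.1 == p.2.
      by move/fsat_off: Yd; rewrite updx; apply.
    move: Y1; rewrite (encV_onto YR Yd) card_encV.
    set X := [set x | _] => X1; have /cards1P[x ->] : #|X| == 1.
      by move: X1; rewrite /minn; case: ltnP => // _ /eqP.
    by rewrite -/(okX x) IHx => Hx; exists x.
  exists (encV [set x]); rewrite encV_sub /= lset_mem ?updx ?encV_sub //.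
  rewrite card_encV cards1 /= IHx Hx andbT; apply/fsat_off; rewrite updx ?encV_sub //.
  exact: encV_diag.
- have okE z : z \in edges F ->
      fsat R (trans D b d.+1 sv (d :: se) sV sE) (upd env (inord d) (encE [set z])) =
      sat b v [tuple of z :: e] W E.
    move=> zE; apply: IH => // i.
    + by have [lt Ej] := Hv i; rewrite updd //; split=> //; apply: leqW.
    + case: (unliftP ord0 i) => [j ->|->]; last by rewrite /= updx tnth0.
      by have [lt [? Ej]] := He j; rewrite tnthS /= updd //; split=> //; apply: leqW.
    + by have [lt Ej] := HV i; rewrite updd //; split=> //; apply: leqW.
    + by have [lt [? Ej]] := HE i; rewrite updd //; split=> //; apply: leqW.
  apply/existsP/existsP => [[Y /and4P[YR Yd]]|[z /andP[zE Hz]]].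
    rewrite /= lset_mem ?updx // => Y1.
    have {}Yd : forall p, p \in Y -> p.1 != p.2.
      by move/fsat_diag: Yd; rewrite updx; apply.
    have [Z ZE YZ] := encE_onto YR Yd; move: Y1; rewrite YZ card_encE // => Z1.
    have /cards1P[z zZ] : #|Z| == 1.
      by move: Z1; rewrite /minn; case: ltnP => // _ /eqP.
    rewrite zZ okE => [Hz|]; last by rewrite -sub1set -zZ.
    by exists z; rewrite Hz andbT -sub1set -zZ.
  have zE' : [set z] \subset edges F by rewrite sub1set.
  exists (encE [set z]); rewrite encE_sub /= lset_mem ?updx ?encE_sub //.
  rewrite card_encE // cards1 /= okE // Hz andbT.
  by apply/fsat_diag; rewrite updx ?encE_sub // => p; apply: encE_off.
- have okX X : fsat R (trans D b d.+1 sv se (d :: sV) sE) (upd env (inord d) (encV X)) =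
      sat b v e [tuple of X :: W] E.
    apply: IH => // i.
    + by have [lt Ej] := Hv i; rewrite updd //; split=> //; apply: leqW.
    + by have [lt [? Ej]] := He i; rewrite updd //; split=> //; apply: leqW.
    + case: (unliftP ord0 i) => [j ->|->]; last by rewrite /= updx tnth0.
      by have [lt Ej] := HV j; rewrite tnthS /= updd //; split=> //; apply: leqW.
    + by have [lt [? Ej]] := HE i; rewrite updd //; split=> //; apply: leqW.
  apply/existsP/existsP => [[Y /and3P[YR Yd]]|[X HX]].
    have {}Yd : forall p, p \in Y -> p.1 == p.2.
      by move/fsat_off: Yd; rewrite updx; apply.
    rewrite (encV_onto YR Yd) okX => H; eexists; exact: H.
  exists (encV X); rewrite encV_sub /= okX HX andbT.
  by apply/fsat_off; rewrite updx ?encV_sub // => p; apply: encV_diag.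
- have okZ (Z : {set {set F}}) : Z \subset edges F ->
      fsat R (trans D b d.+1 sv se sV (d :: sE)) (upd env (inord d) (encE Z)) =
      sat b v e W [tuple of Z :: E].
    move=> ZE; apply: IH => // i.
    + by have [lt Ej] := Hv i; rewrite updd //; split=> //; apply: leqW.
    + by have [lt [? Ej]] := He i; rewrite updd //; split=> //; apply: leqW.
    + by have [lt Ej] := HV i; rewrite updd //; split=> //; apply: leqW.
    + case: (unliftP ord0 i) => [j ->|->]; last by rewrite /= updx tnth0.
      by have [lt [? Ej]] := HE j; rewrite tnthS /= updd //; split=> //; apply: leqW.
  apply/existsP/existsP => [[Y /and3P[YR Yd]]|[Z /andP[ZE HZ]]].
    have {}Yd : forall p, p \in Y -> p.1 != p.2.
      by move/fsat_diag: Yd; rewrite updx; apply.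
    have [Z ZE ->] := encE_onto YR Yd.
    by rewrite okZ // => H; exists Z; rewrite ZE.
  exists (encE Z); rewrite encE_sub /= okZ // HZ andbT.
  by apply/fsat_diag; rewrite updx ?encE_sub // => p; apply: encE_off.
Qed.

End Transfer.

Definition sentence (phi : cmso2_sentence) : form (qdepth phi).+1 :=
  trans (qdepth phi) phi 0 [::] [::] [::] [::].

Lemma models_fsat (F : sgraph) (V : finType) (R : {set V * V}) (f : F -> V)
    (phi : cmso2_sentence) :
  represents R f -> models F phi = fsat R (sentence phi) [ffun=> set0].
Proof.
by move=> rep; rewrite (transfer rep (v := [tuple]) (e := [tuple])
  (W := [tuple]) (E := [tuple])) // => -[].
Qed.

(** * Bilinear operations on terms *)

Import GRing.Theory.

Inductive term (base op : Type) :=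
  | Leaf (b : base)
  | Node (s : op) (t u : term base op).
Arguments Leaf {base op} b.
Arguments Node {base op} s t u.

Fixpoint height base op (t : term base op) : nat :=
  if t is Node _ u v then (maxn (height u) (height v)).+1 else 0.

(** The span of a possibly infinite family: a containing subspace of least dimension lies in every
    other one, since intersecting with the other cannot lower its dimension. *)
Lemma vspan_exists (K : fieldType) (V : vectType K) (P : V -> Prop) :
  exists U : {vspace V}, (forall v, P v -> v \in U) /\
    forall W : {vspace V}, (forall v, P v -> v \in W) -> (U <= W)%VS.
Proof.
pose D d := `[< exists2 U : {vspace V}, (forall v, P v -> v \in U) & \dim U = d >].
have exD : exists d, D d.
  exists (\dim {:V}%VS); apply/asboolP; exists {:V}%VS => // v _.
  exact: memvf.
case: (ex_minnP exD) => d /asboolP[U PU <-] Umin; exists U; split=> // W PW.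
have le : \dim U <= \dim (U :&: W)%VS.
  apply: Umin; apply/asboolP; exists (U :&: W)%VS => // v Pv.
  by rewrite memv_cap PU // PW.
by rewrite -(eqP (_ : (U :&: W)%VS == U)) ?capvSr // eqEdim capvSl.
Qed.

Section BilinearTerms.
Local Open Scope ring_scope.
Variables (base op : Type) (Z : finType) (M : op -> Z -> Z -> Z -> rat).
Let V := {ffun Z -> rat^o}.
Let scaleE (a : rat) (x : rat^o) : a *: x = a * x. Proof. by []. Qed.

Definition bilin s (x y : V) : V :=
  [ffun z => \sum_z1 \sum_z2 M s z z1 z2 * (x z1 * y z2)].

Definition bilinr s (y x : V) : V := bilin s x y.

Fact bilin_linear s x : linear (bilin s x).
Proof.
move=> a u v; apply/ffunP=> z; rewrite !ffunE scaler_sumr -big_split /=.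
apply: eq_bigr => z1 _; rewrite scaler_sumr -big_split /=.
apply: eq_bigr => z2 _; rewrite !ffunE !scaleE !mulrDr; congr (_ + _).
by rewrite [RHS]mulrCA; congr (_ * _); rewrite mulrCA.
Qed.

Fact bilinr_linear s y : linear (bilinr s y).
Proof.
move=> a u v; apply/ffunP=> z; rewrite !ffunE scaler_sumr -big_split /=.
apply: eq_bigr => z1 _; rewrite scaler_sumr -big_split /=.
apply: eq_bigr => z2 _; rewrite !ffunE !scaleE mulrDl mulrDr.
by congr (_ + _); rewrite [RHS]mulrCA; congr (_ * _); rewrite mulrA.
Qed.

HB.instance Definition _ s x :=
  GRing.isLinear.Build rat V V _ (bilin s x) (@bilin_linear s x).
HB.instance Definition _ s y :=
  GRing.isLinear.Build rat V V _ (bilinr s y) (@bilinr_linear s y).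

Variable L : Z -> rat.

Definition functional (x : V) : rat^o := \sum_z L z * x z.

Fact functional_linear : linear functional.
Proof.
move=> a u v; rewrite /functional scaler_sumr -big_split /=.
by apply: eq_bigr => z _; rewrite !ffunE !scaleE mulrDr mulrCA.
Qed.

HB.instance Definition _ :=
  GRing.isLinear.Build rat V rat^o _ functional functional_linear.

Variable vec : term base op -> V.
Hypothesis vec_node : forall s t u, vec (Node s t u) = bilin s (vec t) (vec u).

(* The span of the vectors of the terms of height at most [h] depends only on
   the one for [h - 1], and can grow at most [#|Z|] times. *)
Lemma small_witness t : functional (vec t) != 0 ->
  exists2 t', (height t' <= #|Z|)%N & functional (vec t') != 0.
Proof.
have /choice[S HS] h := vspan_exists
  (fun v : V => exists2 t, (height t <= h)%N & v = vec t).
have memS h u : (height u <= h)%N -> vec u \in S h.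
  by move=> le; apply: (HS h).1; exists u.
have Smin h (W : {vspace V}) :
    (forall u, (height u <= h)%N -> vec u \in W) -> (S h <= W)%VS.
  by move=> HW; apply: (HS h).2 => _ [u le ->]; apply: HW.
have Smono h : (S h <= S h.+1)%VS.
  by apply: Smin => u le; apply: memS; apply: leqW.
(* Closure passes from the generators to their span one argument at a time, through preimages of
   [S h.+1] under the two partial linear maps. *)
have bilS s h x y : x \in S h -> y \in S h -> bilin s x y \in S h.+1.
  have H1 u : (height u <= h)%N -> (S h <= linfun (bilin s (vec u)) @^-1: S h.+1)%VS.
    move=> leu; apply: Smin => v lev; rewrite -memv_preim lfunE /= -vec_node.
    by apply: memS; rewrite /= ltnS geq_max leu.
  move=> Sx Sy; have : (S h <= linfun (bilinr s y) @^-1: S h.+1)%VS.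
    apply: Smin => u leu; rewrite -memv_preim lfunE /=.
    by have /subvP/(_ y Sy) := H1 u leu; rewrite -memv_preim lfunE.
  by move=> /subvP/(_ x Sx); rewrite -memv_preim lfunE.
have Sstep h : (S h.+1 <= S h)%VS -> (S h.+2 <= S h.+1)%VS.
  move=> /subvP le; apply: Smin => -[b|s u v] ht; first exact: memS.
  rewrite vec_node; move: ht; rewrite /= ltnS geq_max => /andP[leu lev].
  by apply: bilS; apply: le; apply: memS.
have [h leh Sh] : exists2 h, (h <= #|Z|)%N & (S h.+1 <= S h)%VS.
  apply: contrapT => no.
  (* If every inclusion up to index [#|Z|] were strict, the dimension would reach [#|Z|.+1], more
     than that of the whole space. *)
  have grow h : (h <= #|Z|.+1)%N -> (h <= \dim (S h))%N.
    elim: h => // h IH lth; apply: leq_ltn_trans (IH (ltnW lth)) _.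
    rewrite ltn_neqAle dimvS // andbT; apply: contra_notN no => /eqP E.
    exists h => //; suff /eqP-> : S h == S h.+1 by [].
    by rewrite eqEdim Smono E /=.
  have := leq_trans (grow _ (leqnn _)) (dimvS (subvf _)).
  by rewrite dimvf /dim /= muln1 ltnn.
have Sall m : (S (h + m)%N <= S h)%VS /\ (S (h + m).+1%N <= S (h + m)%N)%VS.
  elim: m => [|m [IH1 IH2]]; rewrite ?addn0 // addnS; split; last exact: Sstep.
  exact: subv_trans IH2 IH1.
move=> nz; apply: contrapT => no.
(* A functional vanishing on all terms of height at most [#|Z|] vanishes on [S h], which by
   stationarity contains the vector of [t]. *)
have : (S h <= lker (linfun functional))%VS.
  apply: Smin => u leu; rewrite memv_ker lfunE /=.
  by apply: contra_notT no => nzu; exists u => //; apply: leq_trans leh.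
have Sht : vec t \in S h.
  by apply: (subvP (Sall (height t)).1); apply: memS; apply: leq_addl.
by move=> /subvP/(_ _ Sht); rewrite memv_ker lfunE /= (negbTE nz).
Qed.

End BilinearTerms.

(** * Gluing along ports *)

Definition pmap2 (A B : Type) (f : A -> B) (p : A * A) := (f p.1, f p.2).

Lemma pmap2_inj (A B : Type) (f : A -> B) : injective f -> injective (pmap2 f).
Proof. by move=> fI [a b] [c d] [/fI-> /fI->]. Qed.

Lemma lholds_map D (A B : eqType) (f : A -> B) (l : lpred D)
    (e : 'I_D -> pred (A * A)) (e' : 'I_D -> pred (B * B)) p :
  injective f ->
  (forall X, [/\ e' X (pmap2 f p) = e X p,
     e' X (f p.1, f p.1) = e X (p.1, p.1) &
     e' X (f p.2, f p.2) = e X (p.2, p.2)]) ->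
  lholds l e' (pmap2 f p) = lholds l e p.
Proof.
move=> fI E; case: l => [X|X Y|X Y|X|X] /=.
- by have [-> _ _] := E X.
- by have [-> _ _] := E X; have [-> _ _] := E Y.
- by have [_ -> ->] := E X; have [-> _ _] := E Y.
- by have [-> _ _] := E X; rewrite (inj_eq fI).
- by have [-> _ _] := E X; rewrite (inj_eq fI).
Qed.

Section Ports.
Variable k : nat.
Notation port := 'I_k.
Implicit Types N : finType.

Definition is_port N (x : port + N) := if x is inl _ then true else false.

(** Pairs of ports can occur in both operands of a gluing, where they would be counted twice; they
    are left to the trace. *)
Definition interior N (p : (port + N) * (port + N)) :=
  ~~ (is_port p.1 && is_port p.2).

Definition inlp N : port -> port + N := inl.

Definition trace N (X : {set (port + N) * (port + N)}) : {set port * port} :=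
  [set q | pmap2 (@inlp N) q \in X].

(** The ends of every pair are present. [LInc] tests diagonal pairs, and restricting a set to an
    operand intersects it with the relation of that operand; this property keeps those tests
    unchanged. *)
Definition refl_closed (V : finType) (R : {set V * V}) :=
  forall p, p \in R -> (p.1, p.1) \in R /\ (p.2, p.2) \in R.

Section Types.
Variable D : nat.

Definition trenv N (e : {ffun 'I_D -> {set (port + N) * (port + N)}}) :
  {ffun 'I_D -> {set port * port}} := [ffun X => trace (e X)].

(** As in a back-and-forth game, a type at [FEx] lists the outcomes of all choices of a set. It
    depends only on the ports and the formula, hence is finite and comparable between graphs with
    different inner vertices. *)
Fixpoint ktype (f : form D) : finType :=
  match f with
  | FCnt l b q r => 'I_q.+1
  | FNot f => ktype f
  | FAnd f g => (ktype f * ktype g)%type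
  | FEx x f => {set {ffun 'I_D -> {set port * port}} * ktype f}
  end.

(* The information on the part of the graph away from the ports that determines
   the truth of [f], whatever is glued to the ports. *)
Fixpoint ty N (R : {set (port + N) * (port + N)}) (f : form D) :
    {ffun 'I_D -> {set (port + N) * (port + N)}} -> ktype f :=
  match f with
  | FCnt l b q r => fun e =>
      inord (summary b q #|[set p in lset R l e | interior p]|)
  | FNot f => fun e => ty R f e
  | FAnd f g => fun e => (ty R f e, ty R g e)
  | FEx x f => fun e =>
      [set (trenv (upd e x Y), ty R f (upd e x Y)) | Y in powerset R]
  end.

Lemma inord_summary_inj b q m n :
  inord (summary b q m) = inord (summary b q n) :> 'I_q.+1 ->
  summary b q m = summary b q n.
Proof. by move/(congr1 val); rewrite /= !inordK // summary_lt. Qed.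

Lemma inlp_inj N : injective (@inlp N). Proof. by move=> i j []. Qed.

Lemma lholds_trace N (e : {ffun 'I_D -> {set (port + N) * (port + N)}}) l q :
  lholds l (fun X => mem (e X)) (pmap2 (@inlp N) q) =
  lholds l (fun X => mem (trenv e X)) q.
Proof.
apply: lholds_map => [|X]; first exact: inlp_inj.
by rewrite ffunE; split; symmetry; apply: in_set.
Qed.

Definition trset (T : {set port * port}) l
    (e : {ffun 'I_D -> {set port * port}}) : {set port * port} :=
  [set q in T | lholds l (fun X => mem (e X)) q].

Lemma not_interior N (p : (port + N) * (port + N)) :
  ~~ interior p -> exists q, p = pmap2 (@inlp N) q.
Proof. by case: p => [[i|n] [j|m]] //= _; exists (i, j). Qed.

Lemma card_port_part N (R : {set (port + N) * (port + N)}) l e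
    (P : pred (port * port)) (Q : pred ((port + N) * (port + N))) :
  (forall q, Q (pmap2 (@inlp N) q) = P q) ->
  #|[set p in lset R l e | ~~ interior p && Q p]| =
  #|[set q in trset (trace R) l (trenv e) | P q]|.
Proof.
move=> PQ; rewrite -(card_imset _ (pmap2_inj (@inlp_inj N))).
apply: eq_card => p; apply/idP/imsetP => [|[q]].
  rewrite inE [p \in lset _ _ _]inE => /andP[/andP[pR lp] /andP[pi Qp]].
  have [q pq] := not_interior pi; exists q => //; rewrite pq in pR lp Qp.
  by rewrite !inE pR -lholds_trace lp -PQ Qp.
by rewrite !inE -lholds_trace => /andP[/andP[H1 H2] H3] ->; rewrite H1 H2 PQ H3.
Qed.

Lemma card_split N (A : {set (port + N) * (port + N)}) (Q : pred _) :
  #|A| = #|[set p in A | Q p]| + #|[set p in A | ~~ Q p]|.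
Proof.
rewrite -(cardsID [set p | Q p] A); congr (_ + _); apply: eq_card => p.
  by rewrite !inE.
by rewrite !inE andbC.
Qed.

(** A count splits into the pairs of ports, determined by the traces, and the interior pairs, whose
    summary is the type. *)
Lemma fsat_ty N N' (R : {set (port + N) * (port + N)})
    (R' : {set (port + N') * (port + N')}) f e e' :
  trace R = trace R' -> trenv e = trenv e' -> ty R f e = ty R' f e' ->
  fsat R f e = fsat R' f e'.
Proof.
move=> ER; elim: f e e' => [l b q r|f IH|f IHf g IHg|x f IH] e e' Ee /=.
- move/inord_summary_inj => E; congr (_ == _).
  rewrite (card_split (lset R l e) (@interior N)).
  rewrite (card_split (lset R' l e') (@interior N')).
  apply: summary_add => //; congr (summary _ _ _).
  have H (M : finType) (S : {set (port + M) * (port + M)}) ee :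
      [set p in lset S l ee | ~~ interior p] =
      [set p in lset S l ee | ~~ interior p && predT p].
    by apply/setP=> p; rewrite !inE andbT.
  by rewrite !H !(@card_port_part _ _ _ _ predT) // ER Ee.
- by move=> E; rewrite (IH _ _ Ee E).
- by case=> E1 E2; rewrite (IHf _ _ Ee E1) (IHg _ _ Ee E2).
- move=> E; apply/existsP/existsP => -[Y /andP[YR Hf]].
    have : (trenv (upd e x Y), ty R f (upd e x Y)) \in
      [set (trenv (upd e' x Y), ty R' f (upd e' x Y)) | Y in powerset R'].
      by rewrite -E; apply/imsetP; exists Y; rewrite ?powersetE.
    move=> /imsetP[Y']; rewrite powersetE => YR' [E1 E2]; exists Y'.
    by rewrite YR' -(IH _ _ E1 E2).
  have : (trenv (upd e' x Y), ty R' f (upd e' x Y)) \in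
    [set (trenv (upd e x Y), ty R f (upd e x Y)) | Y in powerset R].
    by rewrite E; apply/imsetP; exists Y; rewrite ?powersetE.
  move=> /imsetP[Y']; rewrite powersetE => YR' [E1 E2]; exists Y'.
  by rewrite YR' (IH _ _ (esym E1) (esym E2)).
Qed.

End Types.

Section Glue.
Variables (S : {set port}) (Na Nb : finType).

Definition glued : finType := (port + (Na + (port + Nb)))%type.

Definition emb1 (x : port + Na) : glued :=
  match x with inl i => inl i | inr n => inr (inl n) end.

Definition emb2 (x : port + Nb) : glued :=
  match x with
  | inl i => if i \in S then inl i else inr (inr (inl i))
  | inr n => inr (inr (inr n))
  end.

Lemma emb1_inj : injective emb1.
Proof. by move=> [i|m] [j|n] //= [->]. Qed.

Lemma emb2_inj : injective emb2.
Proof.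
move=> [i|m] [j|n] //=; try by case: ifP.
  by case: ifP; case: ifP => // _ _ [->].
by case=> ->.
Qed.

Lemma emb_meet x y : emb1 x = emb2 y ->
  exists2 i, i \in S & x = inl i /\ y = inl i.
Proof.
by case: x y => [i|m] [j|n] //=; case: ifP => // jS [->]; exists j.
Qed.

Lemma emb2_inl y i : emb2 y = inl i -> i \in S /\ y = inl i.
Proof. by case: y => [j|n] //=; case: ifP => // jS [<-]. Qed.

Variables (Ra : {set (port + Na) * (port + Na)})
          (Rb : {set (port + Nb) * (port + Nb)}).

Definition glue : {set glued * glued} :=
  pmap2 emb1 @: Ra :|: pmap2 emb2 @: Rb.

Definition res1 (X : {set glued * glued}) : {set (port + Na) * (port + Na)} :=
  [set p in Ra | pmap2 emb1 p \in X].
Definition res2 (X : {set glued * glued}) : {set (port + Nb) * (port + Nb)} :=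
  [set p in Rb | pmap2 emb2 p \in X].

Definition inS (q : port * port) := (q.1 \in S) && (q.2 \in S).

Lemma trace_glue (X : {set glued * glued}) : X \subset glue ->
  trace X = trace (res1 X) :|: [set q in trace (res2 X) | inS q].
Proof.
move=> /subsetP XG; apply/setP=> -[i j]; rewrite !inE.
apply/idP/orP => [H|[/andP[]//|/andP[/andP[_ H] /andP[/= iS jS]]]]; last first.
  by move: H; rewrite /pmap2 /= iS jS.
have := XG _ H; rewrite inE => /orP[] /imsetP[[x y] pR [E1 E2]].
  left; rewrite H andbT.
  suff -> : pmap2 (@inlp Na) (i, j) = (x, y) by [].
  by apply: (pmap2_inj emb1_inj); rewrite /pmap2 /= -E1 -E2.
have [iS xE] := emb2_inl (esym E1); have [jS yE] := emb2_inl (esym E2).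
right; rewrite /inS iS jS /= andbT; rewrite xE yE in pR; rewrite pR /=.
by rewrite /pmap2 /= iS jS.
Qed.

Hypotheses (cRa : refl_closed Ra) (cRb : refl_closed Rb).

Lemma glue_closed : refl_closed glue.
Proof.
move=> p /setUP[] /imsetP[q qR ->].
  by have [H1 H2] := cRa qR; split; rewrite inE; apply/orP; left;
     apply: (imset_f (pmap2 emb1)) (_ : (_, _) \in Ra).
by have [H1 H2] := cRb qR; split; rewrite inE; apply/orP; right;
   apply: (imset_f (pmap2 emb2)) (_ : (_, _) \in Rb).
Qed.

Lemma glue1 p : p \in Ra -> pmap2 emb1 p \in glue.
Proof. by move=> pR; rewrite inE imset_f. Qed.

Lemma glue2 p : p \in Rb -> pmap2 emb2 p \in glue.
Proof. by move=> pR; rewrite inE imset_f ?orbT. Qed.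

Variable D : nat.
Variable e : {ffun 'I_D -> {set glued * glued}}.

Definition renv1 := [ffun X => res1 (e X)].
Definition renv2 := [ffun X => res2 (e X)].

Lemma lholds1 l p : p \in Ra ->
  lholds l (fun X => mem (e X)) (pmap2 emb1 p) =
  lholds l (fun X => mem (renv1 X)) p.
Proof.
move=> pR; have [p1R p2R] := cRa pR.
apply: lholds_map => [|X]; first exact: emb1_inj.
rewrite ffunE; split; symmetry.
- by rewrite -[RHS]andTb -pR; apply: in_set.
- by rewrite -[RHS]andTb -p1R; apply: in_set.
- by rewrite -[RHS]andTb -p2R; apply: in_set.
Qed.

Lemma lholds2 l p : p \in Rb ->
  lholds l (fun X => mem (e X)) (pmap2 emb2 p) =
  lholds l (fun X => mem (renv2 X)) p.
Proof.
move=> pR; have [p1R p2R] := cRb pR.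
apply: lholds_map => [|X]; first exact: emb2_inj.
rewrite ffunE; split; symmetry.
- by rewrite -[RHS]andTb -pR; apply: in_set.
- by rewrite -[RHS]andTb -p1R; apply: in_set.
- by rewrite -[RHS]andTb -p2R; apply: in_set.
Qed.

(** The last summand consists of port pairs of the second operand that do not lie within [S]: an end
    of such a pair becomes an inner vertex, so the pair becomes interior. *)
Lemma card_glue l :
  #|[set p in lset glue l e | interior p]| =
  #|[set p in lset Ra l renv1 | interior p]| +
  (#|[set p in lset Rb l renv2 | interior p]| +
   #|[set q in trset (trace Rb) l (trenv renv2) | ~~ inS q]|).
Proof.
pose Q p := [exists q, [&& p == pmap2 (@inlp Nb) q & inS q]].
pose A1 := [set p in lset Ra l renv1 | interior p].
pose A2 := [set p in lset Rb l renv2 | ~~ Q p].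
have QP q : Q (pmap2 (@inlp Nb) q) = inS q.
  apply/existsP/idP => [[q' /andP[/eqP E]]|H]; last by exists q; rewrite eqxx.
  by rewrite (pmap2_inj (@inlp_inj Nb) E).
have Qint p : interior p -> ~~ Q p.
  by apply: contraTN => /existsP[q /andP[/eqP->]].
have -> : [set p in lset glue l e | interior p] =
    pmap2 emb1 @: A1 :|: pmap2 emb2 @: A2.
  apply/setP=> p; rewrite [in RHS]inE.
  apply/idP/orP => [|[]/imsetP[p']].
  - rewrite !inE -andbA => /and3P[/orP[]/imsetP[p' pR ->] lp pi]; [left|right].
      apply: imset_f; rewrite !inE pR -lholds1 // lp /=.
      by move: pi; case: (p') => [[i|m] [j|n]].
    apply: imset_f; rewrite !inE pR -lholds2 // lp /=.
    apply: contraL pi => /existsP[[i j] /andP[/eqP-> /andP[/= iS jS]]].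
    by rewrite /pmap2 /= iS jS.
  - rewrite !inE -andbA => /and3P[pR lp pi] ->; rewrite lholds1 // lp andbT.
    apply/andP; split; first by rewrite imset_f.
    by move: pi; case: (p') => [[i|m] [j|n]].
  rewrite !inE -andbA => /and3P[pR lp pi] ->; rewrite lholds2 // lp andbT.
  apply/andP; split; first by rewrite imset_f ?orbT.
  move: pi; case: (p') => [[i|m] [j|n]] //=; rewrite /interior /=; do ?case: ifP => //.
  by move=> iS jS; rewrite -[(_, _)]/(pmap2 (@inlp Nb) (i, j)) QP /inS /= iS jS.
have dis : [disjoint pmap2 emb1 @: A1 & pmap2 emb2 @: A2].
  apply/pred0P=> p /=; apply/negP=> /andP[/imsetP[[x y] H1 ->] /imsetP[[z w] _ [E1 E2]]].
  have [i _ [xE _]] := emb_meet E1; have [j _ [yE _]] := emb_meet E2.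
  by move: H1; rewrite xE yE !inE andbF.
rewrite cardsU (disjoint_setI0 dis) cards0 subn0.
rewrite !card_imset; [|exact: pmap2_inj emb2_inj|exact: pmap2_inj emb1_inj].
congr (_ + _); rewrite (card_split A2 (@interior Nb)); congr (_ + _).
  apply: eq_card => p; rewrite !inE; case: (boolP (interior p)) => [pi|_].
    by rewrite Qint // !andbT.
  by rewrite !andbF.
rewrite -(@card_port_part _ _ Rb l renv2 (predC inS) (predC Q)) => [|q].
  by apply: eq_card => p; rewrite !inE /= -!andbA; congr (_ && (_ && _)); rewrite andbC.
by rewrite /= QP.
Qed.

End Glue.

(** Only pairs of ports in [S] lie in the images of both operands, so a spurious element can come
    only from a shared pair of [Yb]; the hypothesis excludes it. *)
Lemma res1_glue S (Na Nb : finType) (Ra Ya : {set (port + Na) * (port + Na)})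
    (Yb : {set (port + Nb) * (port + Nb)}) :
  Ya \subset Ra ->
  (forall q, q \in trace Yb -> inS S q -> q \in trace Ra -> q \in trace Ya) ->
  res1 Ra (glue S Ya Yb) = Ya.
Proof.
move=> /subsetP YaR H; apply/setP=> p; rewrite !inE.
apply/andP/idP => [[pR /orP[]/imsetP[p' p'Y E]]|pY]; last first.
- by split; [apply: YaR | rewrite imset_f].
- case: p p' E pR p'Y => [x y] [z w] [E1 E2].
  have [i iS [-> zE]] := emb_meet E1; have [j jS [-> wE]] := emb_meet E2.
  rewrite zE wE => pR p'Y; have := H (i, j); rewrite !inE; apply=> //.
  by rewrite /inS iS.
- by rewrite (pmap2_inj (@emb1_inj _ _) E).
Qed.

Lemma res2_glue S (Na Nb : finType) (Ya : {set (port + Na) * (port + Na)})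
    (Rb Yb : {set (port + Nb) * (port + Nb)}) :
  Yb \subset Rb ->
  (forall q, q \in trace Ya -> inS S q -> q \in trace Rb -> q \in trace Yb) ->
  res2 S Rb (glue S Ya Yb) = Yb.
Proof.
move=> /subsetP YbR H; apply/setP=> p; rewrite !inE.
apply/andP/idP => [[pR /orP[]/imsetP[p' p'Y E]]|pY]; last first.
- by split; [apply: YbR | rewrite imset_f ?orbT].
- by rewrite (pmap2_inj (@emb2_inj _ _ _) E).
case: p p' E pR p'Y => [x y] [z w] [E1 E2].
have [i iS [zE ->]] := emb_meet (esym E1); have [j jS [wE ->]] := emb_meet (esym E2).
rewrite zE wE => pR p'Y; have := H (i, j); rewrite !inE; apply=> //.
by rewrite /inS iS.
Qed.

Section Congruence.
Variables (S : {set port}) (D : nat).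

Section OneSide.
Variables (Na Nb Na' Nb' : finType).
Variables (Ra : {set (port + Na) * (port + Na)})
          (Rb : {set (port + Nb) * (port + Nb)})
          (Ra' : {set (port + Na') * (port + Na')})
          (Rb' : {set (port + Nb') * (port + Nb')}).
Hypotheses (Ta : trace Ra = trace Ra') (Tb : trace Rb = trace Rb').

(* A set on the first gluing is split into its two parts; each part is replaced
   by one of the same type, and the results agree on the common ports because
   types record the trace on the ports. *)
Lemma ex_transport (f : form D) (x : 'I_D)
    (e : {ffun 'I_D -> {set glued Na Nb * glued Na Nb}})
    (e' : {ffun 'I_D -> {set glued Na' Nb' * glued Na' Nb'}})
    (Y : {set glued Na Nb * glued Na Nb}) :
  Y \subset glue S Ra Rb ->
  ty Ra (FEx x f) (renv1 Ra e) = ty Ra' (FEx x f) (renv1 Ra' e') ->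
  ty Rb (FEx x f) (renv2 S Rb e) = ty Rb' (FEx x f) (renv2 S Rb' e') ->
  exists Y' : {set glued Na' Nb' * glued Na' Nb'}, [/\ Y' \subset glue S Ra' Rb',
    trenv (renv1 Ra (upd e x Y)) = trenv (renv1 Ra' (upd e' x Y')),
    ty Ra f (renv1 Ra (upd e x Y)) = ty Ra' f (renv1 Ra' (upd e' x Y')),
    trenv (renv2 S Rb (upd e x Y)) = trenv (renv2 S Rb' (upd e' x Y')) &
    ty Rb f (renv2 S Rb (upd e x Y)) = ty Rb' f (renv2 S Rb' (upd e' x Y'))].
Proof.
move=> YG Ea Eb.
have U1 (N1 N2 : finType) (R : {set (port + N1) * (port + N1)})
    (ee : {ffun 'I_D -> {set glued N1 N2 * glued N1 N2}}) Z :
    renv1 R (upd ee x Z) = upd (renv1 R ee) x (res1 R Z).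
  by apply/ffunP=> X; rewrite !ffunE; case: eqP.
have U2 (N1 N2 : finType) (R : {set (port + N2) * (port + N2)})
    (ee : {ffun 'I_D -> {set glued N1 N2 * glued N1 N2}}) Z :
    renv2 S R (upd ee x Z) = upd (renv2 S R ee) x (res2 S R Z).
  by apply/ffunP=> X; rewrite !ffunE; case: eqP.
have : (trenv (upd (renv1 Ra e) x (res1 Ra Y)), ty Ra f (upd (renv1 Ra e) x (res1 Ra Y)))
   \in ty Ra (FEx x f) (renv1 Ra e).
  apply/imsetP; exists (res1 Ra Y) => //; rewrite powersetE.
  by apply/subsetP=> p; rewrite inE => /andP[].
rewrite Ea => /imsetP[Ya]; rewrite powersetE => YaR [Ea1 Ea2].
have : (trenv (upd (renv2 S Rb e) x (res2 S Rb Y)),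
        ty Rb f (upd (renv2 S Rb e) x (res2 S Rb Y)))
   \in ty Rb (FEx x f) (renv2 S Rb e).
  apply/imsetP; exists (res2 S Rb Y) => //; rewrite powersetE.
  by apply/subsetP=> p; rewrite inE => /andP[].
rewrite Eb => /imsetP[Yb]; rewrite powersetE => YbR [Eb1 Eb2].
have tYa : trace (res1 Ra Y) = trace Ya.
  by have /ffunP/(_ x) := Ea1; rewrite !ffunE !eqxx.
have tYb : trace (res2 S Rb Y) = trace Yb.
  by have /ffunP/(_ x) := Eb1; rewrite !ffunE !eqxx.
have R1 : res1 Ra' (glue S Ya Yb) = Ya.
  apply: res1_glue => // -[i j] qY /andP[/= iS jS]; rewrite -Ta -tYa => qR.
  move: qY; rewrite -tYb !inE in qR * => /andP[_].
  by rewrite qR /pmap2 /= iS jS.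
have R2 : res2 S Rb' (glue S Ya Yb) = Yb.
  apply: res2_glue => // -[i j] qY /andP[/= iS jS]; rewrite -Tb -tYb => qR.
  move: qY; rewrite -tYa !inE in qR * => /andP[_].
  by rewrite qR /pmap2 /= iS jS.
exists (glue S Ya Yb); rewrite !U1 !U2 R1 R2; split=> //.
by apply: setUSS; apply: imsetS.
Qed.

End OneSide.

(** At a count, [card_glue] splits the interior pairs and [summary_add] recombines the parts; at a
    quantifier, [ex_transport] is used in both directions. *)
Lemma ty_glue (f : form D) (Na Nb Na' Nb' : finType)
    (Ra : {set (port + Na) * (port + Na)})
    (Rb : {set (port + Nb) * (port + Nb)})
    (Ra' : {set (port + Na') * (port + Na')})
    (Rb' : {set (port + Nb') * (port + Nb')})
    (e : {ffun 'I_D -> {set glued Na Nb * glued Na Nb}})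
    (e' : {ffun 'I_D -> {set glued Na' Nb' * glued Na' Nb'}}) :
  refl_closed Ra -> refl_closed Rb -> refl_closed Ra' -> refl_closed Rb' ->
  trace Ra = trace Ra' -> trace Rb = trace Rb' ->
  (forall X, e X \subset glue S Ra Rb) ->
  (forall X, e' X \subset glue S Ra' Rb') ->
  trenv (renv1 Ra e) = trenv (renv1 Ra' e') ->
  ty Ra f (renv1 Ra e) = ty Ra' f (renv1 Ra' e') ->
  trenv (renv2 S Rb e) = trenv (renv2 S Rb' e') ->
  ty Rb f (renv2 S Rb e) = ty Rb' f (renv2 S Rb' e') ->
  ty (glue S Ra Rb) f e = ty (glue S Ra' Rb') f e'.
Proof.
move=> ca cb ca' cb' Ta Tb.
have trenv_glue (N1 N2 : finType) (R1 : {set (port + N1) * (port + N1)})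
    (R2 : {set (port + N2) * (port + N2)})
    (ee : {ffun 'I_D -> {set glued N1 N2 * glued N1 N2}}) :
    (forall X, ee X \subset glue S R1 R2) ->
    trenv ee = [ffun X => trenv (renv1 R1 ee) X :|:
      [set q in trenv (renv2 S R2 ee) X | inS S q]] :> {ffun 'I_D -> _}.
  by move=> H; apply/ffunP=> X; rewrite !ffunE (trace_glue (H X)).
elim: f e e' => [l b q r|f IH|f IHf g IHg|x f IH] e e' He He' Ea1 Ea2 Eb1 Eb2 /=.
- rewrite !card_glue // Tb Eb1; congr inord.
  apply: summary_add; first exact: inord_summary_inj.
  by apply: summary_add => //; apply: inord_summary_inj.
- exact: IH.
- by case: Ea2 Eb2 => ? ? [? ?]; congr (_, _); [apply: IHf | apply: IHg].
- have updsub (N1 N2 : finType) (R : {set glued N1 N2 * glued N1 N2})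
      (ee : {ffun 'I_D -> {set glued N1 N2 * glued N1 N2}})
      (Y : {set glued N1 N2 * glued N1 N2}) :
      (forall X, ee X \subset R) -> Y \subset R -> forall X, upd ee x Y X \subset R.
    by move=> H YR X; rewrite ffunE; case: eqP.
  apply/eqP; rewrite eqEsubset; apply/andP; split; apply/subsetP=> w;
    move=> /imsetP[Y].
    rewrite powersetE => YG ->.
    have [Y' [YG' A1 A2 B1 B2]] := ex_transport Ta Tb YG Ea2 Eb2.
    apply/imsetP; exists Y'; rewrite ?powersetE //; congr (_, _).
      rewrite (trenv_glue _ _ Ra Rb) ?(trenv_glue _ _ Ra' Rb') ?A1 ?B1 //;
        exact: updsub.
    by apply: IH => //; apply: updsub.
  rewrite powersetE => YG ->.
  have [Y' [YG' A1 A2 B1 B2]] :=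
    ex_transport (esym Ta) (esym Tb) YG (esym Ea2) (esym Eb2).
  apply/imsetP; exists Y'; rewrite ?powersetE //; congr (_, _).
    rewrite (trenv_glue _ _ Ra Rb) ?(trenv_glue _ _ Ra' Rb') -?A1 -?B1 //;
      exact: updsub.
  by symmetry; apply: IH => //; apply: updsub.
Qed.

End Congruence.

(** * Graphs denoted by terms *)

Notation gterm := (term {set port * port} {set port}).

Fixpoint inner (t : gterm) : finType :=
  match t with
  | Leaf _ => void
  | Node _ a b => (inner a + (port + inner b))%type
  end.

(** The conditions make every [E] a legal graph. Orienting edges by the order of the ports ensures
    that two operands never contribute opposite orientations of the same edge. *)
Definition base_rel (E : {set port * port}) : {set port * port} :=
  [set q in E | [&& (q.1, q.1) \in E, (q.2, q.2) \in E & q.1 <= q.2]].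

Fixpoint rel_of (t : gterm) : {set (port + inner t) * (port + inner t)} :=
  match t with
  | Leaf E => pmap2 (@inlp void) @: base_rel E
  | Node P a b => glue P (rel_of a) (rel_of b)
  end.

Lemma rel_of_closed t : refl_closed (rel_of t).
Proof.
elim: t => [E|S a IHa b IHb]; last exact: glue_closed.
move=> p /imsetP[[i j]]; rewrite !inE /= => /and4P[H1 H2 H3 H4] ->.
by split; apply/imsetP; [exists (i, i)|exists (j, j)];
  rewrite ?inE //= ?H2 ?H3 /=.
Qed.

Lemma rel_of_anti t x y : (x, y) \in rel_of t -> (y, x) \in rel_of t -> x = y.
Proof.
(* The induction also carries the orientation of port pairs: it settles the case where the two pairs
   come from different operands, whose ends are then shared ports. *)
suff [A _] : (forall x y, (x, y) \in rel_of t -> (y, x) \in rel_of t -> x = y)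
   /\ (forall i j : port, (inl i, inl j) \in rel_of t -> i <= j) by exact: A.
elim: t {x y} => [E|S a [IHa La] b [IHb Lb]].
  have L (i j : port) : (inl i, inl j) \in rel_of (Leaf E) -> i <= j.
    by move=> /imsetP[[i' j']]; rewrite !inE => /and4P[_ _ _ ?] [-> ->].
  split=> // -[i|[]] [j|[]] H1 H2; congr inl; apply: val_inj; apply/eqP.
  by rewrite eqn_leq !L.
have L (i j : port) : (inl i, inl j) \in rel_of (Node S a b) -> i <= j.
  move=> /setUP[]/imsetP[[x y] H [E1 E2]].
    case: x y H E1 E2 => [i'|m] [j'|n] //= H [E1] [E2].
    by rewrite E1 E2; apply: La.
  have [_ xE] := emb2_inl (esym E1); have [_ yE] := emb2_inl (esym E2).
  by apply: Lb; rewrite -xE -yE.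
split=> // x y H1 H2.
have ports i j : x = inl i -> y = inl j -> x = y.
  move=> xE yE; rewrite xE yE in H1 H2 *; congr inl; apply: val_inj.
  by apply/eqP; rewrite eqn_leq !L.
move: (H1) (H2) => /setUP[]/imsetP[[x1 y1] G1 [/= xE yE]]
  /setUP[]/imsetP[[y2 x2] G2 [/= yE' xE']].
- rewrite xE yE; congr emb1; apply: IHa => //.
  by rewrite -(emb1_inj (etrans (esym xE') xE)) -(emb1_inj (etrans (esym yE') yE)).
- have [i _ [E _]] := emb_meet (etrans (esym xE) xE').
  have [j _ [E' _]] := emb_meet (etrans (esym yE) yE').
  by apply: (ports i j); rewrite ?xE ?yE ?E ?E'.
- have [i _ [E _]] := emb_meet (etrans (esym xE') xE).
  have [j _ [E' _]] := emb_meet (etrans (esym yE') yE).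
  by apply: (ports i j); rewrite ?xE' ?yE' ?E ?E'.
- rewrite xE yE; congr (emb2 S _); apply: IHb => //.
  by rewrite -(emb2_inj (etrans (esym xE') xE)) -(emb2_inj (etrans (esym yE') yE)).
Qed.


End Ports.

(** * Counting homomorphisms *)

Definition oadj (G : sgraph) (a b : option G) : bool :=
  match a, b with Some x, Some y => adj x y | _, _ => false end.

(* Homomorphisms into [G] of the graph coded by [R], with the absent vertices
   sent to [None]. *)
Definition ohom (V : finType) (R : {set V * V}) (G : sgraph)
    (h : {ffun V -> option G}) : bool :=
  [forall x, isSome (h x) == ((x, x) \in R)] &&
  [forall p in R, (p.1 != p.2) ==> oadj (h p.1) (h p.2)].

Definition homs (V : finType) (R : {set V * V}) (G : sgraph) : nat :=
  #|[set h | @ohom V R G h]|.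

Lemma ohomP (V : finType) (R : {set V * V}) (G : sgraph)
    (h : {ffun V -> option G}) :
  reflect ((forall x, isSome (h x) = ((x, x) \in R)) /\
    (forall x y, (x, y) \in R -> x != y -> oadj (h x) (h y))) (ohom R h).
Proof.
apply: (iffP andP) => [[/forallP H1 /forall_inP H2]|[H1 H2]]; split.
- by move=> x; apply/eqP.
- by move=> x y xyR; apply/implyP; apply: (H2 _ xyR).
- by apply/forallP=> x; apply/eqP.
- by apply/forall_inP=> -[x y] xyR; apply/implyP; apply: H2.
Qed.

Lemma hom_homs (F : sgraph) (V : finType) (R : {set V * V}) (f : F -> V) G :
  represents R f -> hom F G = homs R G.
Proof.
move=> rep; have fI := rep_inj rep.
pose ext (h : {ffun F -> G}) : {ffun V -> option G} :=
  [ffun x => omap h [pick y | f y == x]].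
have extf h y : ext h (f y) = Some (h y).
  by rewrite ffunE; case: pickP => [z /eqP/fI->|/(_ y)] //; rewrite eqxx.
have extN h x : (forall y, f y <> x) -> ext h x = None.
  by move=> no; rewrite ffunE; case: pickP => // y /eqP /no.
have extI : injective ext.
  move=> h h' E; apply/ffunP=> y.
  by apply: Some_inj; rewrite -!extf E.
rewrite /hom -(card_imset _ extI); apply: eq_card => h; rewrite [RHS]inE.
apply/imsetP/ohomP => [[h']|[H1 H2]].
  rewrite inE => /forallP hom -> {h}; split=> [x|x y xyR xy].
    have [[y <-]|no] := pselect (exists y, f y = x).
      by rewrite extf (rep_diag rep).
    rewrite extN => [|y E]; last by apply: no; exists y.
    symmetry; apply/negP=> /(rep_codom rep)[y [_ [E _]]]; apply: no; exists y.
    by rewrite E.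
  have [a [b [xE yE]]] := rep_codom rep xyR; rewrite xE yE !extf /= in xy xyR *.
  apply: (implyP (forallP (hom a) b)); apply: (rep_edge rep) => //.
  by apply: contraNneq xy => ->.
have some y : exists z, h (f y) = Some z.
  by have := H1 (f y); rewrite (rep_diag rep); case: (h _) => // z; exists z.
have [h' Hh'] := choice some.
exists [ffun y => h' y].
  rewrite inE; apply/forallP=> x; apply/forallP=> y; apply/implyP=> xy.
  have ne : x != y by apply: contraTneq xy => ->; rewrite adj_irr.
  have := rep_adj rep x y; rewrite xy orbT !ffunE => /orP[] /H2.
    by rewrite (inj_eq fI) !Hh'; apply.
  by rewrite (inj_eq fI) !Hh' eq_sym adj_sym; apply.
apply/ffunP=> x; have [[y <-]|no] := pselect (exists y, f y = x).
  by rewrite extf Hh' ffunE.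
rewrite extN => [|y E]; last by apply: no; exists y.
have := H1 x; case: (h x) => // z /esym /(rep_codom rep)[y [_ [E _]]].
by case: no; exists y.
Qed.

Section HomGlue.
Variables (k : nat) (G : sgraph).
Notation port := 'I_k.
Notation lab := {ffun port -> option G}.

Definition otrace (N : finType) (h : {ffun (port + N) -> option G}) : lab :=
  [ffun i => h (inl i)].

Definition nhom (N : finType) (R : {set (port + N) * (port + N)}) (c : lab) :=
  #|[set h | ohom R h & otrace h == c]|.

Variable S : {set port}.

Definition orelse (a b : option G) := if a is Some _ then a else b.

(** A port absent from one operand imposes no condition. *)
Definition agree (c1 c2 : lab) : bool :=
  [forall i in S, (isSome (c1 i) && isSome (c2 i)) ==> (c1 i == c2 i)].

(** The values of [c2] outside [S] are discarded; summing over them is what forgets those ports. *)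
Definition merge (c1 c2 : lab) : lab :=
  [ffun i => orelse (c1 i) (if i \in S then c2 i else None)].

Variables (Na Nb : finType).
Variables (Ra : {set (port + Na) * (port + Na)})
          (Rb : {set (port + Nb) * (port + Nb)}).
Hypotheses (ca : refl_closed Ra) (cb : refl_closed Rb).

Notation hpair := ({ffun port + Na -> option G} *
  {ffun port + Nb -> option G})%type.
Notation hglued := {ffun glued k Na Nb -> option G}.

Definition comb (h : hpair) :
    {ffun glued k Na Nb -> option G} :=
  [ffun z => match z with
   | inl i => orelse (h.1 (inl i)) (if i \in S then h.2 (inl i) else None)
   | inr (inl n) => h.1 (inr n)
   | inr (inr (inl i)) => if i \in S then None else h.2 (inl i)
   | inr (inr (inr n)) => h.2 (inr n)
   end].

Definition sect1 (h : hglued) : {ffun port + Na -> option G} :=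
  [ffun x => if (x, x) \in Ra then h (emb1 Nb x) else None].
Definition sect2 (h : hglued) : {ffun port + Nb -> option G} :=
  [ffun x => if (x, x) \in Rb then h (emb2 S Na x) else None].

Lemma comb1 (h : hpair) x : isSome (h.1 x) -> comb h (emb1 Nb x) = h.1 x.
Proof. by rewrite ffunE; case: x => [i|n] //=; case: (h.1 _). Qed.

Lemma comb2 (h : hpair) x : agree (otrace h.1) (otrace h.2) ->
  isSome (h.2 x) -> comb h (emb2 S Na x) = h.2 x.
Proof.
move=> /forall_inP ag; rewrite ffunE; case: x => [i|n] //= si.
have [iS|/negPf->] := boolP (i \in S); last by [].
have /implyP := ag i iS; rewrite !ffunE si andbT /= iS.
by case: (h.1 _) => // z /(_ isT)/eqP.
Qed.

Lemma comb_some (h : hpair) z : isSome (comb h z) ->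
  (exists2 x, z = emb1 Nb x & isSome (h.1 x)) \/
  (exists2 x, z = emb2 S Na x & isSome (h.2 x)).
Proof.
rewrite ffunE; case: z => [i|[n|[i|n]]].
- case E : (h.1 (inl i)) => [z|] /=.
    by left; exists (inl i); rewrite //= E.
  by case: ifP => // iS si; right; exists (inl i); rewrite //= iS.
- by left; exists (inr n).
- by case: ifP => // iS si; right; exists (inl i); rewrite //= iS.
- by right; exists (inr n).
Qed.

Lemma comb_ohom (h : hpair) : ohom Ra h.1 -> ohom Rb h.2 ->
  agree (otrace h.1) (otrace h.2) -> ohom (glue S Ra Rb) (comb h).
Proof.
move=> /ohomP[A1 A2] /ohomP[B1 B2] ag; apply/ohomP; split=> [z|z w].
  apply/idP/idP => [/comb_some[[x ->]|[x ->]]|].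
  - by rewrite A1 => /(glue1 S Rb).
  - by rewrite B1 => /(glue2 S Ra).
  move=> /setUP[]/imsetP[[x y] pR [-> _]].
    by have [/= H _] := ca pR; rewrite comb1 A1.
  by have [/= H _] := cb pR; rewrite comb2 ?B1.
move=> /setUP[]/imsetP[[x y] pR [-> ->]] /= ne.
  have [/= H1 H2] := ca pR; rewrite !comb1 ?A1 //; apply: A2 => //.
  by apply: contraNneq ne => ->.
have [/= H1 H2] := cb pR; rewrite !comb2 ?B1 //; apply: B2 => //.
by apply: contraNneq ne => ->.
Qed.

Lemma sect1_ohom (h : hglued) : ohom (glue S Ra Rb) h -> ohom Ra (sect1 h).
Proof.
move=> /ohomP[A1 A2]; apply/ohomP; split=> [x|x y xyR xy].
  by rewrite ffunE; case: ifP => // xR; rewrite A1; apply: (glue1 S Rb xR).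
have [/= H1 H2] := ca xyR; rewrite !ffunE H1 H2; apply: A2.
  exact: (glue1 S Rb xyR).
by rewrite (inj_eq (@emb1_inj _ _ _)).
Qed.

Lemma sect2_ohom (h : hglued) : ohom (glue S Ra Rb) h -> ohom Rb (sect2 h).
Proof.
move=> /ohomP[A1 A2]; apply/ohomP; split=> [x|x y xyR xy].
  by rewrite ffunE; case: ifP => // xR; rewrite A1; apply: (glue2 S Ra xR).
have [/= H1 H2] := cb xyR; rewrite !ffunE H1 H2; apply: A2.
  exact: (glue2 S Ra xyR).
by rewrite (inj_eq (@emb2_inj _ _ _ _)).
Qed.

Lemma sect_agree (h : hglued) : agree (otrace (sect1 h)) (otrace (sect2 h)).
Proof.
apply/forall_inP=> i iS; rewrite !ffunE /= iS.
by apply/implyP; do 2!case: ifP => //; rewrite ?andbF.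
Qed.

Lemma combK (h : hglued) : ohom (glue S Ra Rb) h -> comb (sect1 h, sect2 h) = h.
Proof.
move=> hom; have /ohomP[A1 _] := hom.
have /ohomP[B1 _] : ohom (glue S Ra Rb) (comb (sect1 h, sect2 h)).
  by apply: comb_ohom; rewrite /= ?sect1_ohom ?sect2_ohom ?sect_agree.
have [C1 _] := ohomP _ _ (sect1_ohom hom).
have [C2 _] := ohomP _ _ (sect2_ohom hom).
apply/ffunP=> z; have [zR|zR] := boolP ((z, z) \in glue S Ra Rb); last first.
  have := A1 z; have := B1 z; rewrite (negPf zR).
  by case: (comb _ _) => // _; case: (h z).
move: (zR) => /setUP[]/imsetP[[x y] pR [-> _]].
  have [/= H _] := ca pR; rewrite comb1 ?C1 //= ffunE H //.
have [/= H _] := cb pR; rewrite comb2 ?C2 ?sect_agree //= ffunE H //.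
Qed.

Lemma comb_sect (h : hpair) : ohom Ra h.1 -> ohom Rb h.2 ->
  agree (otrace h.1) (otrace h.2) ->
  sect1 (comb h) = h.1 /\ sect2 (comb h) = h.2.
Proof.
move=> /ohomP[A1 _] /ohomP[B1 _] ag; split; apply/ffunP=> x; rewrite ffunE.
  case: ifP => xR; first by rewrite comb1 ?A1.
  by have := A1 x; rewrite xR; case: (h.1 x).
case: ifP => xR; first by rewrite comb2 ?B1.
by have := B1 x; rewrite xR; case: (h.2 x).
Qed.

Lemma otrace_comb (h : hpair) : otrace (comb h) = merge (otrace h.1) (otrace h.2).
Proof. by apply/ffunP=> i; rewrite !ffunE. Qed.

(** Homomorphisms from the gluing correspond, by [comb] and the two sections, to pairs that agree on
    the shared ports. The coefficients depend on [S] and the labels only, so gluing is bilinear in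
    the counts. *)
Lemma nhom_glue c : nhom (glue S Ra Rb) c =
  \sum_(c1 : lab) \sum_(c2 : lab)
    (agree c1 c2 && (merge c1 c2 == c)) * (nhom Ra c1 * nhom Rb c2).
Proof.
pose A := [set h : hpair |
   [&& ohom Ra h.1, ohom Rb h.2, agree (otrace h.1) (otrace h.2) &
       merge (otrace h.1) (otrace h.2) == c]].
have -> : nhom (glue S Ra Rb) c = #|A|.
  rewrite -(card_in_imset (f := comb)) => [|h h']; last first.
    rewrite !inE => /and4P[H1 H2 H3 _] /and4P[H1' H2' H3' _] E.
    have [E1 E2] := comb_sect H1 H2 H3; have [E1' E2'] := comb_sect H1' H2' H3'.
    by rewrite [h]surjective_pairing [h']surjective_pairing -E1 -E2 -E1' -E2' E.
  apply: eq_card => h; rewrite inE; apply/andP/imsetP => [[hom /eqP tr]|].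
    exists (sect1 h, sect2 h); last by rewrite combK.
    have /= E := otrace_comb (sect1 h, sect2 h).
    by rewrite inE /= sect1_ohom // sect2_ohom // sect_agree -E combK // tr /=.
  move=> [h']; rewrite inE => /and4P[H1 H2 H3 /eqP H4] ->.
  by rewrite otrace_comb H4 comb_ohom.
rewrite -sum1_card pair_bigA /=.
rewrite (partition_big (fun h : {ffun _} * {ffun _} => (otrace h.1, otrace h.2)) predT) //=.
apply: eq_bigr => -[c1 c2] _ /=; rewrite sum1dep_card -cardsX.
case: (boolP (agree c1 c2 && _)) => [/andP[ag mer]|no].
  rewrite mul1n; apply: eq_card => -[h1 h2]; rewrite !inE /= xpair_eqE.
  by case: (otrace h1 =P c1) => [->|_]; case: (otrace h2 =P c2) => [->|_];
    rewrite ?ag ?mer ?(andbT, andbF).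
rewrite mul0n; apply/eqP; rewrite cards_eq0; apply/eqP/setP => -[h1 h2].
rewrite !inE /= xpair_eqE; apply: contraNF no.
by move=> /andP[/and4P[_ _ ? ?] /andP[/eqP<- /eqP<-]]; apply/andP.
Qed.

End HomGlue.

(** * Small counterexamples by linear algebra over types and port labels *)

Section SmallWitness.
Variables (k D : nat) (f : form D) (G H : sgraph).
Notation port := 'I_k.
Notation gterm := (term {set port * port} {set port}).

Notation cls_type := ({set port * port} * ktype k f)%type.

Definition cls (t : gterm) : cls_type :=
  (trace (rel_of t), ty (rel_of t) f [ffun=> set0]).

Lemma trenv0 (N : finType) :
  trenv [ffun=> set0 : {set (port + N) * (port + N)}] = [ffun=> set0] :> {ffun 'I_D -> _}.
Proof. by apply/ffunP=> X; rewrite !ffunE; apply/setP=> p; rewrite !inE. Qed.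

Lemma cls_node S a b a' b' : cls a = cls a' -> cls b = cls b' ->
  cls (Node S a b) = cls (Node S a' b').
Proof.
move=> [Ta Ya] [Tb Yb].
have res1_0 (Na Nb : finType) (R : {set (port + Na) * (port + Na)}) :
    renv1 R [ffun=> set0 : {set glued k Na Nb * glued k Na Nb}] = [ffun=> set0]
    :> {ffun 'I_D -> _}.
  by apply/ffunP=> X; rewrite !ffunE; apply/setP=> p; rewrite !inE andbF.
have res2_0 (Na Nb : finType) (R : {set (port + Nb) * (port + Nb)}) :
    renv2 S R [ffun=> set0 : {set glued k Na Nb * glued k Na Nb}] = [ffun=> set0]
    :> {ffun 'I_D -> _}.
  by apply/ffunP=> X; rewrite !ffunE; apply/setP=> p; rewrite !inE andbF.
have glue_trace (c d : gterm) : trace (rel_of (Node S c d)) =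
    trace (rel_of c) :|: [set q in trace (rel_of d) | inS S q].
  rewrite (trace_glue (S := S) (Ra := rel_of c) (Rb := rel_of d)) //.
  have -> : res1 (rel_of c) (glue S (rel_of c) (rel_of d)) = rel_of c.
    by apply/setP=> p; rewrite inE andb_idr // => /glue1->.
  suff -> : res2 S (rel_of d) (glue S (rel_of c) (rel_of d)) = rel_of d by [].
  by apply/setP=> p; rewrite inE andb_idr // => /glue2->.
rewrite /cls !glue_trace Ta Tb; congr (_, _).
apply: ty_glue; rewrite ?res1_0 ?res2_0 ?trenv0 //;
  try exact: rel_of_closed; by move=> X; rewrite ffunE sub0set.
Qed.

Notation index := (cls_type * ({ffun port -> option G} + {ffun port -> option H}))%type.

(** Each vector lives in the block of its class, so that a functional can ignore the classes where
    [f] fails. *)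
Definition tvec (t : gterm) : {ffun index -> rat^o} :=
  [ffun z => if z.1 == cls t then
     match z.2 with
     | inl c => (nhom (rel_of t) c)%:R
     | inr c => (nhom (rel_of t) c)%:R
     end%R else 0%R].

(** By [cls_node] the class of a node is a function of the classes of its operands. The function is
    chosen classically and is arbitrary on classes that no term realises. *)
Lemma exists_cls_node : exists gam : {set port} -> cls_type -> cls_type -> cls_type,
  forall S a b, gam S (cls a) (cls b) = cls (Node S a b).
Proof.
have /choice[gam Hgam] (x : {set port} * cls_type * cls_type) : exists c,
    forall a b, x.1.2 = cls a -> x.2 = cls b -> c = cls (Node x.1.1 a b).
  have [[[a b] [Ea Eb]]|no] := pselect (exists ab : gterm * gterm,
      x.1.2 = cls ab.1 /\ x.2 = cls ab.2).
    exists (cls (Node x.1.1 a b)) => a' b' Ea' Eb'.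
    by apply: cls_node; rewrite -?Ea -?Eb.
  by exists x.2 => a b Ea Eb; case: no; exists (a, b).
by exists (fun S c d => gam (S, c, d)) => S a b; apply: (Hgam (S, _, _)).
Qed.

Local Open Scope ring_scope.
Import GRing.Theory.

Lemma small_counterexample (t : gterm) :
  fsat (rel_of t) f [ffun=> set0] -> homs (rel_of t) G <> homs (rel_of t) H ->
  exists t' : gterm, [/\ (height t' <= #|{: index}|)%N,
    fsat (rel_of t') f [ffun=> set0] & homs (rel_of t') G <> homs (rel_of t') H].
Proof.
move=> ft nt; have [gam Hgam] := exists_cls_node.
(* Labels into [G] and labels into [H] never interact, so the two counts evolve side by side under
   one operation. *)
pose M S (z z1 z2 : index) : rat := if z.1 == gam S z1.1 z2.1 then
  match z.2, z1.2, z2.2 with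
  | inl c, inl c1, inl c2 => (agree S c1 c2 && (merge S c1 c2 == c))%:R
  | inr c, inr c1, inr c2 => (agree S c1 c2 && (merge S c1 c2 == c))%:R
  | _, _, _ => 0
  end else 0.
pose acc (c : cls_type) := `[< exists2 u : gterm, cls u = c &
  fsat (rel_of u) f [ffun=> set0] >].
have accP (u : gterm) : acc (cls u) = fsat (rel_of u) f [ffun=> set0].
  apply/asboolP/idP => [[w [E1 E2] fw]|fu]; last by exists u.
  by rewrite -(fsat_ty E1 _ E2) // !trenv0.
(* Summing the counts over all labels of the ports gives the total count. This functional therefore
   takes the difference of the totals on terms satisfying [f], and 0 on the others. *)
pose L (z : index) : rat := if acc z.1 then (if z.2 is inl _ then 1 else -1) else 0.
have sum_cls (c0 : cls_type) (T : finType) (F : cls_type * T -> rat) :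
    (forall z, z.1 != c0 -> F z = 0) -> \sum_z F z = \sum_i F (c0, i).
  move=> F0; rewrite (eq_bigr (fun z => F (z.1, z.2))) => [|[]//].
  rewrite -(pair_bigA _ (fun c i => F (c, i))) /= (bigD1 c0) //= addrC big1 ?add0r //.
  by move=> c ne; apply: big1 => i _; apply: F0.
have node S (a b : gterm) : tvec (Node S a b) = bilin M S (tvec a) (tvec b).
  apply/ffunP=> -[c i]; rewrite !ffunE /=.
  rewrite (sum_cls (cls a)) => [|[c1 i1] /negPf ne]; last first.
    by apply: big1 => z2 _; rewrite !ffunE /= ne mul0r mulr0.
  transitivity (\sum_i1 \sum_i2 M S (c, i) (cls a, i1) (cls b, i2) *
      (tvec a (cls a, i1) * tvec b (cls b, i2))); last first.
    apply: eq_bigr => i1 _; rewrite (sum_cls (cls b)) // => -[c2 i2] /negPf ne.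
    by rewrite !ffunE /= ne !mulr0.
  rewrite /M /= Hgam; case: eqP => _; last first.
    by symmetry; apply: big1 => i1 _; apply: big1 => i2 _; rewrite mul0r.
  case: i => c'.
    rewrite big_sumType /= [X in _ + X]big1 ?addr0 => [|i1 _]; last first.
      by apply: big1 => i2 _; rewrite mul0r.
    rewrite nhom_glue ?natr_sum; [|exact: rel_of_closed|exact: rel_of_closed].
    apply: eq_bigr => c1 _; rewrite natr_sum big_sumType /= [X in _ + X]big1 ?addr0.
      by apply: eq_bigr => c2 _; rewrite !natrM !ffunE /= !eqxx.
    by move=> i2 _; rewrite mul0r.
  rewrite big_sumType /= [X in X + _]big1 ?add0r => [|i1 _]; last first.
    by apply: big1 => i2 _; rewrite mul0r.
  rewrite nhom_glue ?natr_sum; [|exact: rel_of_closed|exact: rel_of_closed].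
  apply: eq_bigr => c1 _; rewrite natr_sum big_sumType /= [X in X + _]big1 ?add0r.
    by apply: eq_bigr => c2 _; rewrite !natrM !ffunE /= !eqxx.
  by move=> i2 _; rewrite mul0r.
have homsE (X : sgraph) (u : gterm) :
    \sum_(c : {ffun port -> option X}) (nhom (rel_of u) c)%:R = (homs (rel_of u) X)%:R :> rat.
  rewrite -natr_sum; congr (_%:R); rewrite /homs -sum1_card.
  rewrite (partition_big (@otrace _ _ _) predT) //=; apply: eq_bigr => c _.
  by rewrite sum1dep_card; apply: eq_card => h; rewrite !inE.
have funE (u : gterm) : functional L (tvec u) =
    if fsat (rel_of u) f [ffun=> set0] then
      (homs (rel_of u) G)%:R - (homs (rel_of u) H)%:R else 0.
  rewrite /functional (sum_cls (cls u)) => [|[c i] /negPf ne]; last first.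
    by rewrite !ffunE /= ne mulr0.
  rewrite /L /= accP; case: ifP => _; last by apply: big1 => i _; rewrite mul0r.
  rewrite big_sumType /= -!homsE -sumrN; congr (_ + _); apply: eq_bigr => c _.
    by rewrite !ffunE /= eqxx mul1r.
  by rewrite !ffunE /= eqxx mulN1r.
have nz (u : gterm) : (functional L (tvec u) != 0) =
    fsat (rel_of u) f [ffun=> set0] && (homs (rel_of u) G != homs (rel_of u) H).
  by rewrite funE; case: ifP => _; rewrite ?eqxx //= subr_eq0 Num.Theory.eqr_nat.
have [|t' ht'] := small_witness (L := L) node (t := t).
  by rewrite nz ft; apply/eqP.
by rewrite nz => /andP[ft' /eqP nt']; exists t'.
Qed.

End SmallWitness.

(** With the ports included, sizes are additive: the vertices of a node, present or absent, are the
    disjoint union of those of its operands. Hence the size at most doubles with each level. *)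
Lemma card_inner k (t : term {set 'I_k * 'I_k} {set 'I_k}) :
  k + #|inner t| <= k * 2 ^ height t.
Proof.
elim: t => [E|S a IHa b IHb] /=; first by rewrite card_void addn0 muln1.
rewrite !card_sum card_ord expnS mulnCA mul2n -addnn addnA.
apply: leq_add.
  by apply: leq_trans IHa _; rewrite leq_mul2l leq_pexp2l ?leq_maxl ?orbT.
by apply: leq_trans IHb _; rewrite leq_mul2l leq_pexp2l ?leq_maxr ?orbT.
Qed.

(** * Tree decompositions as terms *)

Section TreeInduction.
Variable T : sgraph.
Hypothesis treeT : is_tree T.

Definition cut (s t : T) : rel T :=
  [rel a b | adj a b && ~~ (((a == s) && (b == t)) || ((a == t) && (b == s)))].

Lemma cut_sym s t : symmetric (cut s t).
Proof.
move=> a b; rewrite /cut /= adj_sym; congr (_ && ~~ _).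
by rewrite orbC ![(_ == s) && _]andbC ![(_ == t) && _]andbC.
Qed.

(** A simple path from [s] to [t] that avoids the edge between them has at least two edges, so that
    edge closes it to a cycle on at least three nodes. *)
Lemma bridge s t : adj s t -> ~~ connect (cut s t) s t.
Proof.
move=> st; apply/negP=> /connectP[p0 /shortenP[p pth unq _] tE].
have [_ acy] := treeT.
suff : size (s :: p) < 3.
  case: p pth {unq} tE => [|x [|y p]] //= pth tE _.
    by rewrite tE adj_irr in st.
  by move: pth; rewrite -tE /cut /= !eqxx andbF.
apply: acy; rewrite /ucycle unq andbT /= rcons_path -tE adj_sym st andbT.
by apply: sub_path pth => a b /andP[].
Qed.

Lemma connect_within (e : rel T) t a : connect e t a ->
  connect [rel x y | [&& e x y, connect e t x & connect e t y]] t a.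
Proof.
set e' := [rel x y | _]; move=> /connectP[p pth ->].
suff H x : connect e t x -> path e x p -> connect e' x (last x p) by exact: H.
elim: p x {pth} => [|y p IH] x tx //= /andP[xy pth].
have ty : connect e t y by apply: connect_trans tx (connect1 xy).
by apply: connect_trans (IH y ty pth); apply: connect1; rewrite /= xy tx.
Qed.

(* Every connected set of nodes with at least two elements is split in two
   connected sets by removing any edge at its root. *)
Lemma tree_split_ind (P : {set T} -> T -> Prop) :
  (forall t, P [set t] t) ->
  (forall (A B : {set T}) s t, s \in A -> t \in B -> adj s t ->
     (forall a, a \in A -> connect (cut s t) s a) ->
     (forall b, b \in B -> connect (cut s t) t b) ->
     P A s -> P B t -> P (A :|: B) t) ->
  forall t, P [set: T] t.
Proof.
move=> P1 Pstep.
pose within (A : {set T}) : rel T := [rel a b | [&& adj a b, a \in A & b \in A]].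
suff main n (A : {set T}) t : #|A| <= n -> t \in A ->
    (forall a, a \in A -> connect (within A) t a) -> P A t.
  move=> t; apply: (main #|[set: T]|) => // a _; have [[_ conn] _] := treeT.
  by apply: connect_sub (conn t a) => x y xy; apply: connect1; rewrite /within /= xy !inE.
elim: n A t => [|n IH] A t.
  by rewrite leqn0 cards_eq0 => /eqP->; rewrite inE.
move=> szA tA conA.
have [->|[b bA bt]] : A = [set t] \/ exists2 b, b \in A & b != t.
- have [/subsetP sub|/subsetPn[b bA]] := boolP (A \subset [set t]).
    by left; apply/eqP; rewrite eqEsubset sub1set tA andbT; apply/subsetP.
  by rewrite inE => bt; right; exists b.
- exact: P1.
have [s tsA] : exists s, within A t s.
  have /connectP[[|s p] /= pth E] := conA b bA; first by rewrite E eqxx in bt.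
  by exists s; case/andP: pth.
have /and3P[ts _ sA] := tsA.
pose e : rel T := [rel x y | [&& cut s t x y, x \in A & y \in A]].
have e_sym : connect_sym e.
  by apply: sym_connect_sym => x y; rewrite /e /= cut_sym; congr (_ && _); rewrite andbC.
have e_cut x y : connect e x y -> connect (cut s t) x y.
  by apply: connect_sub => u w /andP[uw _]; apply: connect1.
have c_sym : connect_sym (cut s t) by apply: sym_connect_sym; apply: cut_sym.
have st : adj s t by rewrite adj_sym.
have inA x y : x \in A -> connect e x y -> y \in A.
  move=> xA /connectP[p pth ->].
  by elim: p x xA pth => //= z p IHp x _ /andP[/and3P[_ _ zA]] /IHp; apply.
pose C x := [set a | connect e x a].
have AE : A = C s :|: C t.
  apply/setP=> a; rewrite !inE; apply/idP/orP => [aA|[]]; try exact: inA.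
  have /connectP[p pth ->] := conA a aA.
  suff H x : connect e s x \/ connect e t x -> path (within A) x p ->
      connect e s (last x p) \/ connect e t (last x p).
    by apply: H => //; right; apply: connect0.
  elim: p x {pth} => //= y p IHp x sx /andP[/and3P[xy xA yA] pth]; apply: IHp => //.
  have [|] := boolP (e x y).
    by case: sx => sx exy; [left|right]; apply: connect_trans sx (connect1 exy).
  rewrite /e /cut /= xy xA yA /= andbT negbK => /orP[]/andP[_ /eqP->].
    by right; apply: connect0.
  by left; apply: connect0.
(* A component that misses some node of [A] is smaller than [A]; each of the two components misses
   the root of the other. *)
have small x y : x \in A -> y \in A -> ~~ connect e x y -> #|C x| <= n.
  move=> xA yA no; rewrite -ltnS; apply: leq_trans szA; apply: proper_card.
  apply/properP; split; last by exists y; rewrite ?inE.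
  by apply/subsetP=> a; rewrite inE; apply: inA.
have nost : ~~ connect e s t by apply: contra (bridge st); apply: e_cut.
have conC x a : a \in C x -> connect (within (C x)) x a.
  rewrite inE => /connect_within; apply: connect_sub => u w.
  move=> /and3P[/and3P[/andP[uw _] _ _] H1 H2].
  by apply: connect1; rewrite /within /= uw !inE H1.
rewrite AE; apply: (Pstep _ _ s t) => //.
- by rewrite inE connect0.
- by rewrite inE connect0.
- by move=> a; rewrite inE => /e_cut.
- by move=> a; rewrite inE => /e_cut.
- by apply: IH; [apply: (small s t) | rewrite inE connect0 | exact: conC].
- apply: IH; [apply: (small t s) => // | rewrite inE connect0 // | exact: conC].
  by rewrite e_sym.
Qed.

End TreeInduction.

(** Induction on [A]: a permutation that is right except at [x] is corrected by swapping its value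
    at [f x] with [g x]. By injectivity, no other prescribed value moves. *)
Lemma perm_extend (X : finType) k (A : {set X}) (f g : X -> 'I_k) :
  {in A &, injective f} -> {in A &, injective g} ->
  exists s : {perm 'I_k}, {in A, forall x, s (f x) = g x}.
Proof.
have [n] := ubnP #|A|; elim: n A => // n IH A0; rewrite ltnS => szA fI gI.
have [A00|[x xA0]] := set_0Vmem A0; first by exists 1%g => x; rewrite A00 inE.
have [A xA A0E] : exists2 A : {set X}, x \notin A & A0 = x |: A.
  by exists (A0 :\ x); rewrite ?setD1K // !inE eqxx.
move: szA fI gI; rewrite {}A0E cardsU1 xA => szA fI gI {A0 xA0}.
have [||s Hs] := IH A szA.
- by move=> y z yA zA; apply: fI; rewrite inE ?yA ?zA orbT.
- by move=> y z yA zA; apply: gI; rewrite inE ?yA ?zA orbT.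
exists (s * tperm (s (f x)) (g x))%g => y; rewrite !inE permM.
case: eqP => [->|/eqP yx] /= yA; first by rewrite tpermL.
have x1 : x \in x |: A by rewrite setU11.
have y1 : y \in x |: A by rewrite inE yA orbT.
rewrite (Hs y yA) tpermD //.
  rewrite -(Hs y yA) (inj_eq (@perm_inj _ s)); apply: contraNneq yx => E.
  by apply/eqP; symmetry; apply: fI.
by apply: contraNneq yx => E; apply/eqP; symmetry; apply: gI.
Qed.

Section Decomposition.
Variables (F T : sgraph) (bag : T -> {set F}) (k : nat).
Hypothesis td : tree_decomposition bag.
Hypothesis bag_size : forall t, #|bag t| <= k.+1.

Definition support (A : {set T}) : {set F} := \bigcup_(a in A) bag a.

Lemma bag_support (A : {set T}) t : t \in A -> {subset bag t <= support A}.
Proof. by move=> tA x xt; apply/bigcupP; exists t. Qed.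

(** The bags containing [x] form a connected set meeting both sides. If [x] missed [bag s] or
    [bag t], a walk through these bags would join the two sides without the edge, against
    [bridge]. *)
Lemma support_meet (A B : {set T}) s t x :
  adj s t ->
  (forall a, a \in A -> connect (cut s t) s a) ->
  (forall b, b \in B -> connect (cut s t) t b) ->
  x \in support A -> x \in support B -> (x \in bag s) && (x \in bag t).
Proof.
move=> st HA HB /bigcupP[a aA xa] /bigcupP[b bB xb].
have c_sym : connect_sym (cut s t) by apply: sym_connect_sym; apply: cut_sym.
apply: contraT => no; apply: contraTT (bridge (td_tree td) st) => _; rewrite negbK.
apply: connect_trans (HA a aA) _.
apply: connect_trans (_ : connect (cut s t) b t); last by rewrite c_sym HB.
apply: connect_sub (td_connected td xa xb) => u w /and3P[uw xu xw].
apply: connect1; rewrite /cut /= uw /=; apply: contra no => /orP[]/andP[/eqP<- /eqP<-].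
  by rewrite xu xw.
by rewrite xu xw.
Qed.

(** The colours will be the port names. At a split, the colours of one side are permuted to match
    the other on [bag s :&: bag t], which by [support_meet] contains all shared vertices. *)
Lemma rainbow_colouring : exists c : F -> 'I_k.+1,
  forall t, {in bag t &, injective c}.
Proof.
have [[T0 _] _] := td_tree td; have /card_gt0P[t0 _] := T0.
suff [c Hc] : exists c : F -> 'I_k.+1,
    forall t, t \in [set: T] -> {in bag t &, injective c}.
  by exists c => t; apply: Hc; rewrite inE.
apply: (@tree_split_ind T (td_tree td) (fun A _ => exists c : F -> 'I_k.+1,
    forall t, t \in A -> {in bag t &, injective c}) _ _ t0) => [t|A B s t sA tB st HA HB].
  exists (fun x => inord (index x (enum (bag t)))) => _ /set1P-> x y xt yt.
  have lt z : z \in bag t -> index z (enum (bag t)) < k.+1.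
    move=> zt; apply: leq_trans (bag_size t).
    by rewrite cardE index_mem mem_enum.
  move=> /(congr1 val); rewrite /= !inordK ?lt // => /index_inj.
  by apply; rewrite ?mem_enum.
move=> [c1 H1] [c2 H2].
have [p Hp] : exists p : {perm 'I_k.+1},
    {in bag s :&: bag t, forall x, p (c1 x) = c2 x}.
  apply: perm_extend => x y /setIP[xs xt] /setIP[ys yt]; first exact: H1 sA x y xs ys.
  exact: H2 tB x y xt yt.
pose c x := if x \in support B then c2 x else p (c1 x).
have cA x : x \in support A -> c x = p (c1 x).
  move=> xA; rewrite /c; case: ifP => // xB; rewrite Hp // inE.
  exact: support_meet st HA HB xA xB.
exists c => a /setUP[aA|aB] x y xa ya.
  rewrite !cA ?(bag_support aA) // => /perm_inj; exact: H1 aA x y xa ya.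
rewrite /c !(bag_support aB) //; exact: H2 aB x y xa ya.
Qed.

Section Term.
Variable c : F -> 'I_k.+1.
Hypothesis c_inj : forall t, {in bag t &, injective c}.

(** Orienting by colour matches the port order imposed by [base_rel]; adjacent vertices in a common
    bag have distinct colours. *)
Definition seen (A : {set T}) x y :=
  [exists a in A, [&& x \in bag a, y \in bag a & (x == y) || (adj x y && (c x < c y))]].

Lemma seenU (A B : {set T}) x y : seen (A :|: B) x y = seen A x y || seen B x y.
Proof.
apply/exists_inP/orP => [[a /setUP[aA|aB] H]|[]/exists_inP[a aA H]].
- by left; apply/exists_inP; exists a.
- by right; apply/exists_inP; exists a.
- by exists a; rewrite // inE aA.
- by exists a; rewrite // inE aA orbT.
Qed.

Lemma seen_support A x y : seen A x y -> (x \in support A) && (y \in support A).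
Proof.
by move=> /exists_inP[a aA /and3P[xa ya _]]; rewrite !(bag_support aA).
Qed.

Notation gterm := (term {set 'I_k.+1 * 'I_k.+1} {set 'I_k.+1}).

(** The root bag is kept on the ports named by its colours, and every other vertex is inner. At a
    split, the vertices common to the two end bags are glued and the remaining ports on the side of
    [s] are forgotten. *)
Lemma partial_term t : exists (u : gterm) (g : F -> 'I_k.+1 + inner u),
  [/\ {in support [set: T] &, injective g},
      forall p, p \in rel_of u <-> exists x y, seen [set: T] x y /\ p = (g x, g y),
      forall x, x \in bag t -> g x = inl (c x) &
      forall x, x \in support [set: T] -> x \notin bag t -> exists n, g x = inr n].
Proof.
pose P (A : {set T}) (t : T) := exists (u : gterm) (g : F -> 'I_k.+1 + inner u),
  [/\ {in support A &, injective g},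
      forall p, p \in rel_of u <-> exists x y, seen A x y /\ p = (g x, g y),
      forall x, x \in bag t -> g x = inl (c x) &
      forall x, x \in support A -> x \notin bag t -> exists n, g x = inr n].
apply: (@tree_split_ind T (td_tree td) P) => {t}
  [t|A B s t sA tB st HA HB [ua [ga [gaI gaR gaP gaN]]] [ub [gb [gbI gbR gbP gbN]]]].
  pose E := [set (c p.1, c p.2) | p in [pred p | seen [set t] p.1 p.2]].
  have supp x : x \in support [set t] -> x \in bag t.
    by move=> /bigcupP[_ /set1P->].
  exists (Leaf E), (fun x => inl (c x)); split=> //.
  - by move=> x y /supp xt /supp yt [E']; apply: (c_inj xt yt E').
  - move=> p; split=> [/imsetP[q]|[x [y [xy ->]]]].
      by rewrite !inE => /and4P[/imsetP[[x y] /= xy ->] _ _ _ ->]; exists x, y.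
    apply/imsetP; exists (c x, c y) => //; rewrite inE /=.
    have in_E x' y' : seen [set t] x' y' -> (c x', c y') \in E.
      by move=> H; apply/imsetP; exists (x', y').
    have /exists_inP[a at_ /and3P[xa ya _]] := xy.
    rewrite !in_E //=.
    + by case/exists_inP: xy => a' _ /and3P[_ _ /orP[/eqP->|/andP[_ /ltnW]]].
    + by apply/exists_inP; exists a => //; rewrite ya eqxx.
    + by apply/exists_inP; exists a => //; rewrite xa eqxx.
  - by move=> x /supp ->.
have meet x : x \in support A -> x \in support B -> (x \in bag s) && (x \in bag t).
  exact: support_meet st HA HB.
pose S := [set c x | x in bag s :&: bag t].
have inS x : x \in bag s -> x \in bag t -> c x \in S.
  by move=> xs xt; apply/imsetP; exists x; rewrite // inE xs.
(* [ub] comes first because the first operand keeps its ports and [t] is the root of the union. *)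
pose g x : 'I_k.+1 + inner (Node S ub ua) :=
  if x \in support B then emb1 _ (gb x) else emb2 S _ (ga x).
have gA x : x \in support A -> g x = emb2 S _ (ga x).
  move=> xA; rewrite /g; case: ifP => // xB.
  have /andP[xs xt] := meet x xA xB.
  by rewrite gaP // gbP //= inS.
have gB x : x \in support B -> g x = emb1 _ (gb x) by rewrite /g => ->.
have mixed x y : x \in support B -> y \in support A -> g x = g y -> x = y.
  move=> xB yA; rewrite gB // gA // => /emb_meet[i /imsetP[z /setIP[zs zt] ->] [E1 E2]].
  have yz : y = z.
    have ys : y \in bag s.
      by apply: contraT => /(gaN y yA)[n]; rewrite E2.
    by move: E2; rewrite gaP // => -[E]; apply: (c_inj ys zs E).
  have xt : x \in bag t.
    by apply: contraT => /(gbN x xB)[n]; rewrite E1.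
  by rewrite yz; move: E1; rewrite gbP // => -[E]; apply: (c_inj xt zt E).
have suppU x : x \in support (A :|: B) = (x \in support A) || (x \in support B).
  by rewrite /support bigcup_setU inE.
exists (Node S ub ua), g; split.
- move=> x y; rewrite !suppU => /orP[xA|xB] /orP[yA|yB].
  + by rewrite !gA // => /emb2_inj; apply: gaI.
  + by move/esym/mixed => H; symmetry; apply: H.
  + exact: mixed.
  + by rewrite !gB // => /emb1_inj; apply: gbI.
- move=> p; rewrite /= inE; split=> [/orP[]/imsetP[q]|[x [y []]]].
  + move=> /gbR[x [y [xy ->]]] ->; exists x, y; rewrite seenU xy orbT; split=> //.
    by have /andP[xB yB] := seen_support xy; rewrite !gB.
  + move=> /gaR[x [y [xy ->]]] ->; exists x, y; rewrite seenU xy; split=> //.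
    by have /andP[xA yA] := seen_support xy; rewrite !gA.
  rewrite seenU => /orP[] xy ->; have /andP[xS yS] := seen_support xy.
    rewrite !gA //; apply/orP; right; apply/imsetP; exists (ga x, ga y) => //.
    by apply/gaR; exists x, y.
  rewrite !gB //; apply/orP; left; apply/imsetP; exists (gb x, gb y) => //.
  by apply/gbR; exists x, y.
- by move=> x xt; rewrite gB ?gbP // (bag_support tB).
- move=> x; rewrite suppU => xAB xt; have [xB|xB] := boolP (x \in support B).
    by have [n E] := gbN x xB xt; rewrite gB // E; exists (inl n).
  have xA : x \in support A by move: xAB; rewrite (negPf xB) orbF.
  rewrite gA //; have [xs|xs] := boolP (x \in bag s); last first.
    by have [n ->] := gaN x xA xs; exists (inr (inr n)).
  rewrite gaP //=; case: ifP => [/imsetP[z /setIP[zs zt] E]|_].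
    by rewrite (c_inj xs zs E) zt in xt.
  (* A vertex of [bag s] outside [bag t]: its port is not in [S] and has just been forgotten. *)
  by exists (inr (inl (c x))).
Qed.

End Term.

Lemma decomposition_term :
  exists (u : term {set 'I_k.+1 * 'I_k.+1} {set 'I_k.+1})
         (g : F -> 'I_k.+1 + inner u), represents (rel_of u) g.
Proof.
have [c c_inj] := rainbow_colouring.
have [[T0 _] _] := td_tree td; have /card_gt0P[t0 _] := T0.
have [u [g [gI gR _ _]]] := partial_term c_inj t0.
have supp x : x \in support [set: T].
  by have [t xt] := td_vertex td x; apply: bag_support xt; rewrite inE.
have gI' : injective g by move=> x y; apply: gI.
have gE x y : (g x, g y) \in rel_of u <-> seen c [set: T] x y.
  split=> [/gR[x' [y' [xy [/gI'-> /gI'->]]]]//|xy].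
  by apply/gR; exists x, y.
exists u, g; split=> //.
- by move=> p /gR[x [y [_ ->]]]; exists x, y.
- move=> x y; apply/orP/idP.
    by move=> [/gE|/gE] /exists_inP[a _ /and3P[_ _ /orP[/eqP->|/andP[xy _]]]];
      rewrite ?eqxx // ?xy ?orbT // adj_sym xy orbT.
  move=> /orP[/eqP->|xy].
    have [t yt] := td_vertex td y; left; apply/gE/exists_inP.
    by exists t; rewrite // yt eqxx.
  have [t /andP[xt yt]] := td_edge td xy.
  have [lt|gt|/val_inj E] := ltngtP (c x) (c y).
  + by left; apply/gE/exists_inP; exists t; rewrite // xt yt xy lt orbT.
  + by right; apply/gE/exists_inP; exists t; rewrite // xt yt adj_sym xy gt orbT.
  + by rewrite (c_inj t _ _ xt yt E) adj_irr in xy.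
- by move=> x y H1 H2; apply: gI'; apply: rel_of_anti H1 H2.
Qed.

End Decomposition.

(** * Numerical codes *)

(** [CodeSeq.code (n :: s)] is [2 ^ n] times an odd number, so the head is a 2-adic valuation,
    written as a bounded sum to be recursive. Its value 0 at 0, the code of the empty list, matches
    the default of [nth]. *)
Definition code_head c := \sum_(i < c) (c %% 2 ^ i.+1 == 0).
Definition code_tail c := c %/ 2 ^ code_head c %/ 2.
Definition code_nth c i := code_head (iter i code_tail c).

Lemma code_head_cons n m : code_head (2 ^ n * m.*2.+1) = n.
Proof.
rewrite /code_head; set c := 2 ^ n * _.
have lec : n <= c.
  by apply: leq_trans (ltnW (ltn_expl n (ltnSn 1))) _; rewrite leq_pmulr.
rewrite -[RHS](sum_ltn lec); apply: eq_bigr => i _; congr nat_of_bool.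
rewrite -/(dvdn _ _) pfactor_dvdn ?muln_gt0 ?expn_gt0 //.
rewrite lognM ?expn_gt0 // pfactorK // (_ : logn 2 _ = 0) ?addn0 //.
by rewrite lognE /= dvdn2 /= odd_double.
Qed.

Lemma code_tail_cons n m : code_tail (2 ^ n * m.*2.+1) = m.
Proof.
rewrite /code_tail code_head_cons mulKn ?expn_gt0 // divn2.
by rewrite -[m.*2.+1]/(true + m.*2) half_bit_double.
Qed.

Lemma code_nth_code s i : code_nth (CodeSeq.code s) i = nth 0 s i.
Proof.
have tail0 : code_tail 0 = 0 by rewrite /code_tail div0n.
have -> : code_nth (CodeSeq.code s) i = code_head (CodeSeq.code (drop i s)).
  congr code_head; elim: i s => [|i IH] [|n s] //=.
    by rewrite [iter i _ _](IH [::]).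
  by rewrite -iterS iterSr [code_tail _]code_tail_cons IH.
rewrite -[in RHS](addn0 i) -nth_drop; case: (drop i s) => [|n s'] /=.
  by rewrite /code_head big_ord0.
exact: code_head_cons.
Qed.

Lemma nth_allpairs (A B C : Type) (f : A -> B -> C) s t x0 y0 z0 i j :
  i < size s -> j < size t ->
  nth z0 [seq f x y | x <- s, y <- t] (i * size t + j) =
  f (nth x0 s i) (nth y0 t j).
Proof.
move=> + ltj; elim: s i => // x s IH [|i] /= lti; rewrite nth_cat size_map.
  by rewrite ltj (nth_map y0).
by rewrite mulSn -addnA ltnNge leq_addr /= addKn IH.
Qed.

(** The offset 1 skips the number of vertices, which precedes the matrix. *)
Definition code_adj c i j := code_nth c (1 + (i * code_nth c 0 + j)) == 1.

Lemma code_nth0 G : code_nth (graph_code G) 0 = #|G|.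
Proof. exact: code_nth_code. Qed.

Lemma code_adjE (G : sgraph) (x y : G) :
  code_adj (graph_code G) (enum_rank x) (enum_rank y) = adj x y.
Proof.
rewrite /code_adj code_nth0 code_nth_code /=.
have szE : size (enum G) = #|G| by rewrite -cardE.
rewrite -[X in _ * X]szE (@nth_allpairs _ _ _ _ (enum G) (enum G) x y) ?szE ?ltn_ord //.
by rewrite !nth_enum_rank; case: (adj x y).
Qed.

Definition undigits b m (a : nat -> nat) := \sum_(i < m) a i * b ^ i.
Definition digit b X i := X %/ b ^ i %% b.

Lemma undigits_lt b m a : (forall i, i < m -> a i < b) -> undigits b m a < b ^ m.
Proof.
rewrite /undigits; elim: m => [|m IH] H; first by rewrite big_ord0.
rewrite big_ord_recr /= expnS.
have := IH (fun i lti => H i (ltnW lti)); have := H m (ltnSn m).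
move: (\sum_(i < m) _) (b ^ m) (a m) => x y z zb xy.
have : (z.+1) * y <= b * y by rewrite leq_mul2r zb orbT.
by rewrite mulSn; lia.
Qed.

Lemma digitK b m a i : (forall i, i < m -> a i < b) -> i < m ->
  digit b (undigits b m a) i = a i.
Proof.
rewrite /digit /undigits; elim: m => // m IH H lti; rewrite big_ord_recr /=.
have b0 : 0 < b by apply: leq_ltn_trans (H m (ltnSn m)).
have H' j : j < m -> a j < b by move/ltnW/H.
move: lti; rewrite ltnS leq_eqVlt => /orP[/eqP->|lti].
  rewrite divnDMl ?expn_gt0 ?b0 // divn_small ?add0n ?modn_small ?H //.
  exact: undigits_lt.
have -> : b ^ m = b * b ^ (m - i.+1) * b ^ i.
  by rewrite -expnS -expnD; congr (_ ^ _); lia.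
rewrite mulnA divnDMl ?expn_gt0 ?b0 // -modnDmr mulnCA modnMr addn0.
exact: IH.
Qed.

Definition bit X i := digit 2 X i == 1.

(* The diagonal and order conditions make every number code a graph. *)
Definition rbit B R i j :=
  [&& bit R (i * B + j), bit R (i * B + i), bit R (j * B + j) & i <= j].

Definition code_set B X : {set 'I_B * 'I_B} :=
  [set p : 'I_B * 'I_B | bit X (p.1 * B + p.2)].
Definition code_rel B R : {set 'I_B * 'I_B} := [set p : 'I_B * 'I_B | rbit B R p.1 p.2].

Lemma code_index_inj B (i j i' j' : 'I_B) :
  i * B + j = i' * B + j' -> i = i' /\ j = j'.
Proof.
move=> E; have B0 : 0 < B by apply: leq_ltn_trans (ltn_ord i).
have H := congr1 (divn^~ B) E; have H' := congr1 (modn^~ B) E.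
rewrite !divnMDl ?divn_small ?addn0 // in H.
rewrite !modnMDl !modn_small // in H'.
by split; apply: val_inj.
Qed.

Lemma code_set_onto B (A : {set 'I_B * 'I_B}) :
  exists2 X, X < 2 ^ (B * B) & code_set B X = A.
Proof.
pose a n : nat := [exists p in A, n == p.1 * B + p.2].
have a2 n : n < B * B -> a n < 2 by rewrite /a; case: [exists _ in _, _].
exists (undigits 2 (B * B) a); first exact: undigits_lt.
apply/setP=> -[i j]; rewrite inE /bit digitK //=.
  rewrite /a eqb1; apply/exists_inP/idP => [[[i' j'] H /eqP/code_index_inj[-> ->]]//|H].
  by exists (i, j).
have : i * B + j < i.+1 * B by rewrite mulSn addnC ltn_add2r.
by move/leq_trans; apply; rewrite leq_mul2r ltn_ord orbT.
Qed.

Lemma graph_of_rel (V : finType) (R : {set V * V}) : refl_closed R ->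
  (forall x y, (x, y) \in R -> (y, x) \in R -> x = y) ->
  exists (F : sgraph) (f : F -> V), represents R f.
Proof.
move=> cR anti.
pose T : finType := {x : V | (x, x) \in R}.
pose e : rel T := fun u w => (u != w) &&
  (((val u, val w) \in R) || ((val w, val u) \in R)).
have e_sym : symmetric e by move=> u w; rewrite /e eq_sym orbC.
have e_irr : irreflexive e by move=> u; rewrite /e eqxx.
exists (SGraph e_sym e_irr), val; split.
- exact: val_inj.
- move=> [x y] xyR; have [/= H1 H2] := cR _ xyR.
  by exists (Sub x H1), (Sub y H2); rewrite !SubK.
- move=> u w; rewrite /= /e; case: eqP => [->|//] /=.
  by rewrite (valP w).
- by move=> u w H1 H2; apply: val_inj; apply: anti.
Qed.

Lemma graph_of_code B R :
  exists (F : sgraph) (f : F -> 'I_B), represents (code_rel B R) f.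
Proof.
apply: graph_of_rel => [[i j]|i j].
  by rewrite !inE /= /rbit => /and4P[_ -> ->]; rewrite !leqnn.
rewrite !inE /= /rbit => /and4P[_ _ _ ij] /and4P[_ _ _ ji].
by apply: val_inj; apply/eqP; rewrite eqn_leq ij.
Qed.

(** Indices from [#|F|] on stay absent, so the single carrier ['I_B] serves all graphs with at most
    [B] vertices. *)
Lemma code_of_graph (F : sgraph) B : #|F| <= B ->
  exists (R : nat) (f : F -> 'I_B), R < 2 ^ (B * B) /\ represents (code_rel B R) f.
Proof.
move=> le; pose f (x : F) : 'I_B := widen_ord le (enum_rank x).
have fI : injective f by move=> x y /(congr1 val)/= /ord_inj/enum_rank_inj.
have [R ltR RE] := code_set_onto
  [set p : 'I_B * 'I_B | [exists x, exists y,
     [&& (x == y) || adj x y, p == (f x, f y) & f x <= f y]]].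
have bitE (i j : 'I_B) : bit R (i * B + j) =
    [exists x, exists y, [&& (x == y) || adj x y, (i, j) == (f x, f y) & f x <= f y]].
  by move/setP/(_ (i, j)): RE; rewrite !inE.
have bit_diag x : bit R (f x * B + f x).
  by rewrite bitE; apply/existsP; exists x; apply/existsP; exists x; rewrite !eqxx leqnn.
have relE x y : ((f x, f y) \in code_rel B R) = ((x == y) || adj x y) && (f x <= f y).
  rewrite inE /rbit !bit_diag bitE /= ; apply/andP/idP => [[/existsP[x' /existsP[y']]]|].
    by case/and3P=> H /eqP[/ord_inj/enum_rank_inj-> /ord_inj/enum_rank_inj->] -> _; rewrite H.
  move=> /andP[H1 H2]; split=> //; apply/existsP; exists x; apply/existsP; exists y.
  by rewrite H1 eqxx.
exists R, f; split=> //; split=> //.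
- move=> [i j]; rewrite inE => /and4P[]; rewrite bitE.
  by move=> /existsP[x /existsP[y /and3P[_ /eqP E _]]] _ _ _; exists x, y.
- move=> x y; rewrite !relE adj_sym [y == x]eq_sym [adj y x]adj_sym -andb_orr.
  by rewrite leq_total andbT adj_sym.
- move=> x y; rewrite !relE => /andP[_ H1] /andP[_ H2]; apply: fI.
  by apply: val_inj; apply/eqP; rewrite eqn_leq H1.
Qed.

(** * Satisfaction evaluated on numbers *)

Section NumericSatisfaction.
Variable D : nat.

(* The arguments are [B :: R :: X_0 :: ... :: X_(D-1)]. *)
Definition nvar (v : seq nat) (X i j : nat) :=
  bit (nth 0 v X.+2) (i * nth 0 v 0 + j).
Definition nrel (v : seq nat) (i j : nat) := rbit (nth 0 v 0) (nth 0 v 1) i j.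

Definition nlholds (l : lpred D) (v : seq nat) (i j : nat) : bool :=
  match l with
  | LMem X => nvar v X i j
  | LDiff X Y => nvar v X i j && ~~ nvar v Y i j
  | LInc X Y => nvar v Y i j && (nvar v X i i || nvar v X j j)
  | LDiag X => nvar v X i j && (i == j)
  | LOff X => nvar v X i j && (i != j)
  end.

Definition ncount l v :=
  \sum_(i < nth 0 v 0) \sum_(j < nth 0 v 0) (nrel v i j && nlholds l v i j).

Fixpoint nfsat (f : form D) (v : seq nat) : bool :=
  match f with
  | FCnt l b q r => (if b then ncount l v %% q.+1 else minn (ncount l v) q) == r
  | FNot f => ~~ nfsat f v
  | FAnd f g => nfsat f v && nfsat g v
  | FEx x f => [exists Y : 'I_(2 ^ (nth 0 v 0 * nth 0 v 0)),
      [forall i : 'I_(nth 0 v 0), [forall j : 'I_(nth 0 v 0),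
        bit Y (i * nth 0 v 0 + j) ==> nrel v i j]] &&
      nfsat f (set_nth 0 v x.+2 Y)]
  end.

Lemma nfsatE (f : form D) B R xs
    (env : {ffun 'I_D -> {set 'I_B * 'I_B}}) : size xs = D ->
  (forall X, env X = code_set B (nth 0 xs X)) ->
  nfsat f [:: B, R & xs] = fsat (code_rel B R) f env.
Proof.
elim: f xs env => [l b q r|f IH|f IHf g IHg|x f IH] xs env sxs Exs /=.
- congr (_ == _); rewrite /summary.
  suff -> : ncount l [:: B, R & xs] = #|lset (code_rel B R) l env| by [].
  rewrite /ncount /= pair_bigA /= -sum1_card big_mkcond /= [RHS]big_mkcond /=.
  apply: eq_bigr => -[i j] _ /=; rewrite !inE /= -/(nrel [:: B, R & xs] i j).
  have memE X (i' j' : 'I_B) : mem (env X) (i', j') = nvar [:: B, R & xs] X i' j'.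
    by rewrite Exs [LHS]inE.
  suff -> : lholds l (fun X => mem (env X)) (i, j) = nlholds l [:: B, R & xs] i j.
    by case: (_ && _).
  case: l => [X|X Y|X Y|X|X] /=; rewrite -?memE //.
- by rewrite (IH _ env).
- by rewrite (IHf _ env) // (IHg _ env).
have upd_ok (Y : nat) : nfsat f (set_nth 0 [:: B, R & xs] x.+2 Y) =
    fsat (code_rel B R) f (upd env x (code_set B Y)).
  apply: IH => [|X]; first by rewrite size_set_nth sxs; apply/maxn_idPr.
  by rewrite ffunE nth_set_nth /= -val_eqE; case: eqP => // _; apply: Exs.
have sub_ok (Y : nat) : [forall i : 'I_B, [forall j : 'I_B,
    bit Y (i * B + j) ==> nrel [:: B, R & xs] i j]] = (code_set B Y \subset code_rel B R).
  apply/forallP/subsetP => [H [i j]|H i].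
    by rewrite !inE /=; apply: (implyP (forallP (H i) j)).
  by apply/forallP=> j; apply/implyP=> Y1; have := H (i, j); rewrite !inE /=; apply.
apply/existsP/existsP => [[Y /andP[YR]]|[A /andP[AR]]].
  rewrite -[B :: _]/(set_nth 0 [:: B, R & xs] x.+2 Y) upd_ok.
  by exists (code_set B Y); rewrite -sub_ok YR.
have [Y ltY YA] := code_set_onto A; rewrite -YA -upd_ok => H; exists (Ordinal ltY).
by apply/andP; split; last exact: H; rewrite sub_ok YA.
Qed.
End NumericSatisfaction.

(** * The decision procedure *)

(* The number [h] codes a map to [option G] by its digits, [0] standing for
   [None] and [i.+1] for the vertex of [G] with index [i]. *)
Definition nohom B R c h : bool :=
  let d i := digit (code_nth c 0).+1 h i in
  [forall i : 'I_B, (d i != 0) == rbit B R i i] &&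
  [forall i : 'I_B, [forall j : 'I_B, rbit B R i j && (i != j :> nat) ==>
     [&& d i != 0, d j != 0 & code_adj c (d i).-1 (d j).-1]]].

Definition nhoms B R c := \sum_(h < (code_nth c 0).+1 ^ B) nohom B R c h.

Lemma nhomsE B R (G : sgraph) : nhoms B R (graph_code G) = homs (code_rel B R) G.
Proof.
rewrite /nhoms code_nth0.
pose enc (a : option G) : nat := if a is Some x then (enum_rank x).+1 else 0.
have encI : injective enc by move=> [x|] [y|] //= [/val_inj/enum_rank_inj->].
have enc_lt a : enc a < #|G|.+1 by case: a => [x|] //=; rewrite ltnS.
pose dig (h : {ffun 'I_B -> option G}) (i : nat) :=
  if insub i is Some j then enc (h j) else 0.
have digE h (i : 'I_B) : dig h i = enc (h i) by rewrite /dig valK.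
have dig_lt h i : dig h i < #|G|.+1 by rewrite /dig; case: insub.
pose num h : 'I_(#|G|.+1 ^ B) := Ordinal (undigits_lt (fun i (_ : i < B) => dig_lt h i)).
have numK h (i : 'I_B) : digit #|G|.+1 (num h) i = enc (h i).
  by rewrite digitK ?digE.
have numI : injective num.
  by move=> h h' E; apply/ffunP=> i; apply: encI; rewrite -!numK E.
(* [num] is an injection between sets of equal size [#|G|.+1 ^ B], hence a bijection. *)
rewrite (reindex num) /=; last first.
  apply: onW_bij; apply: inj_card_bij numI _.
  by rewrite card_ord card_ffun card_option card_ord.
rewrite /homs -[RHS]sum1_card [RHS]big_mkcond /=; apply: eq_bigr => h _.
rewrite inE; suff -> : nohom B R (graph_code G) (num h) = ohom (code_rel B R) h.
  by case: ohom.
rewrite /nohom code_nth0 /ohom; congr (_ && _).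
  apply: eq_forallb => i; rewrite numK inE /=; congr (_ == _).
  by case: (h i).
apply/forallP/forall_inP => [H [i j]|H i].
  rewrite inE /= => ijR; apply/implyP=> ij.
  have := forallP (H i) j; rewrite ijR (_ : (i != j :> nat) = true) ?val_eqE //= !numK.
  by case: (h i) => [x|] //; case: (h j) => [y|] //=; rewrite code_adjE.
apply/forallP=> j; apply/implyP=> /andP[ijR]; rewrite val_eqE => ij.
have := H (i, j).
rewrite inE /= => /(_ ijR)/implyP/(_ ij); rewrite !numK.
by case: (h i) => [x|] //; case: (h j) => [y|] //=; rewrite code_adjE.
Qed.

Lemma rec_digit m b X i : rec m b -> rec m X -> rec m i ->
  rec m (fun v => digit (b v) (X v) (i v)).
Proof. by move=> Hb HX Hi; apply: rec_mod => //; apply: rec_div => //; apply: rec_exp. Qed.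

Lemma dec_bit m X i : rec m X -> rec m i -> dec m (fun v => bit (X v) (i v)).
Proof.
move=> HX Hi; apply: dec_eq; last exact: rec_const.
by apply: rec_digit => //; apply: rec_const.
Qed.

Lemma dec_rbit m B R i j : rec m B -> rec m R -> rec m i -> rec m j ->
  dec m (fun v => rbit (B v) (R v) (i v) (j v)).
Proof.
move=> HB HR Hi Hj.
have H a b : rec m a -> rec m b -> dec m (fun v => bit (R v) (a v * B v + b v)).
  by move=> Ha Hb; apply: dec_bit => //; apply: rec_add => //; apply: rec_mul.
by apply: dec_and; [exact: H|apply: dec_and; [exact: H|apply: dec_and; [exact: H|]]];
  apply: dec_leq.
Qed.

Lemma rec_code_head m c : rec m c -> rec m (fun v => code_head (c v)).
Proof.
apply: rec_app1; apply: (rec_bigsum (F := fun i v => nth 0 v 0 %% 2 ^ i.+1 == 0)).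
  exact: rec_nth.
apply: rec_nat_eq0; apply: rec_mod; first exact: rec_behead (rec_nth _ _).
by apply: rec_exp; [apply: rec_const | apply: rec_succ; apply: rec_nth].
Qed.

Lemma rec_code_nth m c i : rec m c -> rec m i -> rec m (fun v => code_nth (c v) (i v)).
Proof.
move=> Hc Hi; apply: rec_code_head; apply: rec_iter => //.
apply: rec_div; last exact: rec_const.
apply: rec_div; first exact: rec_nth.
apply: rec_exp; first exact: rec_const.
exact: rec_code_head (rec_nth _ _).
Qed.

Lemma dec_code_adj m c i j : rec m c -> rec m i -> rec m j ->
  dec m (fun v => code_adj (c v) (i v) (j v)).
Proof.
move=> Hc Hi Hj; apply: dec_eq; last exact: rec_const.
apply: rec_code_nth => //; apply: rec_add; first exact: rec_const.
apply: rec_add => //; apply: rec_mul => //; apply: rec_code_nth => //.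
exact: rec_const.
Qed.

Lemma dec_eqb m P Q : dec m P -> dec m Q -> dec m (fun v => P v == Q v).
Proof.
move=> HP HQ; apply: rec_ext (dec_eq HP HQ) => v _.
by case: (P v); case: (Q v).
Qed.

Lemma dec_nohom m B R c h : rec m B -> rec m R -> rec m c -> rec m h ->
  dec m (fun v => nohom (B v) (R v) (c v) (h v)).
Proof.
move=> HB HR Hc Hh.
have dig n (c' h' i' : seq nat -> nat) : rec n c' -> rec n h' -> rec n i' ->
    rec n (fun v => digit (code_nth (c' v) 0).+1 (h' v) (i' v)).
  move=> ? ? ?; apply: rec_digit => //; apply: rec_succ; apply: rec_code_nth => //.
  exact: rec_const.
have HB1 := rec_behead HB; have HR1 := rec_behead HR.
have Hc1 := rec_behead Hc; have Hh1 := rec_behead Hh.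
have HB2 := rec_behead HB1; have HR2 := rec_behead HR1.
have Hc2 := rec_behead Hc1; have Hh2 := rec_behead Hh1.
have N1 : rec m.+2 (fun w => nth 0 (behead w) 0) by exact: rec_behead (rec_nth _ _).
apply: dec_and.
  apply: (dec_forall (P := fun i v =>
    (digit (code_nth (c v) 0).+1 (h v) i != 0) == rbit (B v) (R v) i i)) => //.
  apply: dec_eqb; first by apply: dec_neg; apply: rec_nat_eq0; apply: dig => //; apply: rec_nth.
  by apply: dec_rbit => //; apply: rec_nth.
apply: (dec_forall (P := fun i v => [forall j : 'I_(B v),
  rbit (B v) (R v) i j && (i != j) ==>
  [&& digit (code_nth (c v) 0).+1 (h v) i != 0,
      digit (code_nth (c v) 0).+1 (h v) j != 0 &
      code_adj (c v) (digit (code_nth (c v) 0).+1 (h v) i).-1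
                     (digit (code_nth (c v) 0).+1 (h v) j).-1]])) => //.
apply: (dec_forall (b := fun w => B (behead w)) (P := fun j w =>
  rbit (B (behead w)) (R (behead w)) (nth 0 w 0) j && (nth 0 w 0 != j) ==>
  [&& digit (code_nth (c (behead w)) 0).+1 (h (behead w)) (nth 0 w 0) != 0,
      digit (code_nth (c (behead w)) 0).+1 (h (behead w)) j != 0 &
      code_adj (c (behead w))
        (digit (code_nth (c (behead w)) 0).+1 (h (behead w)) (nth 0 w 0)).-1
                     (digit (code_nth (c (behead w)) 0).+1 (h (behead w)) j).-1])) => //.
have D1 := dig m.+2 _ _ _ Hc2 Hh2 N1.
have D2 := dig m.+2 _ _ _ Hc2 Hh2 (rec_nth _ 0).
apply: dec_imp.
  apply: dec_and; first by apply: dec_rbit => //; apply: rec_nth.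
  by apply: dec_neg; apply: dec_eq => //; apply: rec_nth.
apply: dec_and; first by apply: dec_neg; apply: rec_nat_eq0.
apply: dec_and; first by apply: dec_neg; apply: rec_nat_eq0.
by apply: dec_code_adj => //; apply: rec_pred.
Qed.

Lemma rec_nhoms m B R c : rec m B -> rec m R -> rec m c ->
  rec m (fun v => nhoms (B v) (R v) (c v)).
Proof.
move=> HB HR Hc.
apply: (rec_bigsum (F := fun h v => nohom (B v) (R v) (c v) h)).
  by apply: rec_exp => //; apply: rec_succ; apply: rec_code_nth => //; apply: rec_const.
by apply: dec_nohom; try exact: rec_behead; apply: rec_nth.
Qed.

(** * Recursiveness of satisfaction and of the size bound *)

Section RecSatisfaction.
Variable D : nat.

Lemma dec_nrel m (u : seq nat -> seq nat) i j :
  (forall x, rec m (fun w => nth 0 (u w) x)) -> rec m i -> rec m j ->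
  dec m (fun w => nrel (u w) (i w) (j w)).
Proof. by move=> Hu Hi Hj; apply: dec_rbit. Qed.

Lemma dec_nlholds m (u : seq nat -> seq nat) i j (l : lpred D) :
  (forall x, rec m (fun w => nth 0 (u w) x)) -> rec m i -> rec m j ->
  dec m (fun w => nlholds l (u w) (i w) (j w)).
Proof.
move=> Hu Hi Hj.
have H (X : 'I_D) a b : rec m a -> rec m b -> dec m (fun w => nvar (u w) X (a w) (b w)).
  by move=> Ha Hb; apply: dec_bit => //; apply: rec_add => //; apply: rec_mul.
case: l => [X|X Y|X Y|X|X] /=; first exact: H.
- by apply: dec_and; [|apply: dec_neg]; apply: H.
- by apply: dec_and; [|apply: dec_or]; apply: H.
- by apply: dec_and; [apply: H | apply: dec_eq].
- by apply: dec_and; [apply: H | apply: dec_neg; apply: dec_eq].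
Qed.

Lemma rec_nth_behead m x : rec m.+1 (fun w => nth 0 (behead w) x).
Proof. exact: rec_behead (rec_nth _ _). Qed.

Lemma rec_nth_behead2 m x : rec m.+2 (fun w => nth 0 (behead (behead w)) x).
Proof. exact: rec_behead (rec_nth_behead _ _). Qed.

Lemma rec_ncount m (l : lpred D) : rec m (ncount l).
Proof.
apply: (rec_bigsum (F := fun i v => \sum_(j < nth 0 v 0) (nrel v i j && nlholds l v i j))).
  exact: rec_nth.
apply: (rec_bigsum (b := fun w => nth 0 (behead w) 0) (F := fun j w =>
  nrel (behead w) (nth 0 w 0) j && nlholds l (behead w) (nth 0 w 0) j)).
  exact: rec_nth_behead.
apply: dec_and.
  apply: (@dec_nrel _ (fun w => behead (behead w))) => [x||];
    [exact: rec_nth_behead2 | exact: rec_nth_behead | exact: rec_nth].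
apply: (@dec_nlholds _ (fun w => behead (behead w))) => [x||];
  [exact: rec_nth_behead2 | exact: rec_nth_behead | exact: rec_nth].
Qed.

Lemma dec_nfsat (f : form D) : dec D.+2 (nfsat f).
Proof.
elim: f => [l b q r|f IH|f IHf g IHg|x f IH] /=.
- apply: dec_eq; last exact: rec_const.
  by case: b; [apply: rec_mod|apply: rec_min]; try exact: rec_const; apply: rec_ncount.
- exact: dec_neg.
- exact: dec_and.
apply: (dec_exists (b := fun v => 2 ^ (nth 0 v 0 * nth 0 v 0)) (P := fun Y v =>
  [forall i : 'I_(nth 0 v 0), [forall j : 'I_(nth 0 v 0),
     bit Y (i * nth 0 v 0 + j) ==> nrel v i j]] && nfsat f (set_nth 0 v x.+2 Y))).
  by apply: rec_exp; [apply: rec_const | apply: rec_mul; apply: rec_nth].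
apply: dec_and.
  apply: (dec_forall (b := fun w => nth 0 (behead w) 0) (P := fun i w =>
    [forall j : 'I_(nth 0 (behead w) 0),
     bit (nth 0 w 0) (i * nth 0 (behead w) 0 + j) ==> nrel (behead w) i j])).
    exact: rec_nth_behead.
  apply: (dec_forall (b := fun w => nth 0 (behead (behead w)) 0) (P := fun j w =>
     bit (nth 0 (behead w) 0) (nth 0 w 0 * nth 0 (behead (behead w)) 0 + j) ==>
     nrel (behead (behead w)) (nth 0 w 0) j)).
    exact: rec_nth_behead2.
  have N0 n : rec n.+3 (fun w => nth 0 (behead (behead (behead w))) 0).
    exact: rec_behead (rec_nth_behead2 _ _).
  apply: dec_imp.
    apply: dec_bit; first exact: rec_nth_behead2.
    apply: rec_add; last exact: rec_nth.
    by apply: rec_mul => //; apply: rec_nth_behead.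
  apply: (@dec_nrel _ (fun w => behead (behead (behead w)))) => [y||];
    [exact: rec_behead (rec_nth_behead2 _ _) | exact: rec_nth_behead | exact: rec_nth].
(* The quantified set is argument 0 of the extended list: it takes position [x.+2], and every other
   position reads its former argument, shifted by one. *)
apply: rec_ext (rec_args (m := D.+3) (gs := [::])
  (s := [seq if i == x.+2 then 0 else i.+1 | i <- iota 0 D.+2]) IH _ _) => [w sw||//].
  congr nat_of_bool; congr nfsat; rewrite cat0s -map_comp.
  have xD := ltn_ord x.
  apply: (@eq_from_nth _ 0).
    by rewrite size_map size_iota size_set_nth size_behead sw; lia.
  move=> i; rewrite size_map size_iota => lti.
  rewrite (nth_map 0) ?size_iota // nth_iota //= nth_set_nth /= add0n.
  by case: eqP => // _; rewrite nth_behead.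
by rewrite size_map size_iota.
Qed.

(** An arithmetic form of [#|ktype k f|]. An environment of traces consists of [D] sets of port
    pairs, whence the factor [(2 ^ (k * k)) ^ D]. *)
Fixpoint ncard (f : form D) (k : nat) : nat :=
  match f with
  | FCnt _ _ q _ => q.+1
  | FNot f => ncard f k
  | FAnd f g => ncard f k * ncard g k
  | FEx _ f => 2 ^ ((2 ^ (k * k)) ^ D * ncard f k)
  end.

Lemma card_set (T : finType) : #|{set T}| = 2 ^ #|T|.
Proof.
rewrite -[#|T|]cardsT -card_powerset; apply: eq_card => A.
by rewrite !inE subsetT.
Qed.

Lemma card_ktype k (f : form D) : #|ktype k f| = ncard f k.
Proof.
elim: f => [l b q r|f IH|f IHf g IHg|x f IH] //=; first by rewrite card_ord.
  by rewrite card_prod IHf IHg.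
by rewrite card_set card_prod card_ffun card_set card_prod !card_ord IH.
Qed.

Lemma rec_ncard m (f : form D) k : rec m k -> rec m (fun v => ncard f (k v)).
Proof.
move=> Hk; elim: f => [l b q r|f IH|f IHf g IHg|x f IH] //=.
- exact: rec_const.
- exact: rec_mul.
- apply: rec_exp; first exact: rec_const.
  apply: rec_mul => //; apply: rec_exp; last exact: rec_const.
  by apply: rec_exp; [apply: rec_const | apply: rec_mul].
Qed.

(* Number of vertices that suffices for a counterexample built with [k] ports
   against graphs with [a] and [b] vertices. *)
Definition size_bound (f : form D) k a b :=
  k * 2 ^ (2 ^ (k * k) * ncard f k * (a.+1 ^ k + b.+1 ^ k)).

Lemma rec_size_bound m (f : form D) k a b : rec m k -> rec m a -> rec m b ->
  rec m (fun v => size_bound f (k v) (a v) (b v)).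
Proof.
move=> Hk Ha Hb; apply: rec_mul => //; apply: rec_exp; first exact: rec_const.
apply: rec_mul; last by apply: rec_add; apply: rec_exp => //; apply: rec_succ.
apply: rec_mul; last exact: rec_ncard.
by apply: rec_exp; [apply: rec_const | apply: rec_mul].
Qed.

Definition agree_upto (f : form D) B cG cH : bool :=
  [forall R : 'I_(2 ^ (B * B)),
     nfsat f [:: B, val R & nseq D 0] ==> (nhoms B R cG == nhoms B R cH)].

Lemma dec_agree_upto m (f : form D) B cG cH : rec m B -> rec m cG -> rec m cH ->
  dec m (fun v => agree_upto f (B v) (cG v) (cH v)).
Proof.
move=> HB HG HH.
apply: (dec_forall (b := fun v => 2 ^ (B v * B v)) (P := fun R v =>
  nfsat f [:: B v, R & nseq D 0] ==> (nhoms (B v) R (cG v) == nhoms (B v) R (cH v)))).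
  by apply: rec_exp; [apply: rec_const | apply: rec_mul].
have HB1 := rec_behead HB.
apply: dec_imp; last first.
  by apply: dec_eq; apply: rec_nhoms => //; try exact: rec_behead; apply: rec_nth.
have szg : size [:: (fun w => B (behead w)), (fun w => nth 0 w 0) &
    nseq D (fun _ : seq nat => 0)] = D.+2 by rewrite /= size_nseq.
apply: rec_ext (rec_comp (gs := [:: (fun w => B (behead w)), (fun w => nth 0 w 0) &
    nseq D (fun _ : seq nat => 0)]) (m := m.+1) (f := fun v => nfsat f v) _ _).
- by move=> v _ /=; rewrite map_nseq.
- by rewrite szg; apply: dec_nfsat.
move=> [|[|i]] /= lti; [exact: HB1 | exact: rec_nth|].
by rewrite nth_nseq if_same; apply: rec_const.
Qed.

End RecSatisfaction.

(** * Reduction to a bounded search *)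

Lemma chi_le (F G : sgraph) : hom F G != 0 -> chi F <= #|G|.
Proof.
rewrite -lt0n => /card_gt0P[h]; rewrite inE => /forallP homh.
rewrite /chi; case: ex_minnP => m _; apply.
apply/existsP; exists [ffun x => enum_rank (h x)].
apply/forallP=> x; apply/forallP=> y; apply/implyP=> xy; rewrite !ffunE.
apply: contraTneq (implyP (forallP (homh x) y) xy) => /enum_rank_inj->.
by rewrite adj_irr.
Qed.

(** Every number codes a graph with at most [B] vertices, and every such graph has a code below
    [2 ^ (B * B)]. *)
Lemma agree_uptoP (phi : cmso2_sentence) B G H :
  reflect (forall F : sgraph, #|F| <= B -> models F phi -> hom F G = hom F H)
    (agree_upto (sentence phi) B (graph_code G) (graph_code H)).
Proof.
have satE (R : nat) : nfsat (sentence phi) [:: B, R & nseq (qdepth phi).+1 0] =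
    fsat (code_rel B R) (sentence phi) [ffun=> set0].
  apply: nfsatE => [|X]; first by rewrite size_nseq.
  rewrite ffunE nth_nseq if_same; apply/setP=> p.
  by rewrite !inE /bit /digit div0n mod0n.
apply: (iffP forallP) => [agr F leF FM|agr R].
  have [R [f [ltR rep]]] := code_of_graph leF.
  have := agr (Ordinal ltR); rewrite /= satE -(models_fsat _ rep) FM /=.
  by rewrite !nhomsE -!(hom_homs _ rep) => /eqP.
have [F [f rep]] := graph_of_code B R.
have leF : #|F| <= B by rewrite -[B]card_ord; apply: leq_card (rep_inj rep).
apply/implyP; rewrite satE -(models_fsat _ rep) !nhomsE -!(hom_homs _ rep) => FM.
by apply/eqP; apply: agr.
Qed.

Lemma bounded_counterexample (phi : cmso2_sentence) (F G H : sgraph) k :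
  tw F <= k -> models F phi -> hom F G <> hom F H ->
  exists F' : sgraph, [/\ #|F'| <= size_bound (sentence phi) k.+1 #|G| #|H|,
    models F' phi & hom F' G <> hom F' H].
Proof.
rewrite /tw; case: ex_minnP => w /asboolP[T [bag [td wE]]] _ lew FM ne.
(* [width] is a truncated predecessor, so the bound [k.+1] also covers a decomposition whose bags
   are all empty. *)
have bag_size t : #|bag t| <= k.+1.
  apply: leq_trans (@leq_bigmax T (fun t => #|bag t|) t) _.
  by apply: leq_trans (leqSpred _) _; rewrite ltnS -/(width bag) wE.
have [t [g rep]] := decomposition_term td bag_size.
have [||t' [ht' ft' nt']] := @small_counterexample _ _ (sentence phi) G H t.
- by rewrite -(models_fsat phi rep).
- by rewrite -!(hom_homs _ rep).
have [F' [f rep']] := graph_of_rel (@rel_of_closed _ t') (@rel_of_anti _ t').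
exists F'; split; first 1 last.
- by rewrite (models_fsat phi rep').
- by rewrite !(hom_homs _ rep').
apply: leq_trans (leq_card f (rep_inj rep')) _.
rewrite card_sum card_ord; apply: leq_trans (card_inner t') _.
rewrite leq_mul2l leq_pexp2l //; apply: leq_trans ht' _.
(* The dimension is the number of traces times the number of types times the number of port labels
   into [G] or [H], where an absent port adds one value. *)
rewrite !card_prod card_sum card_set card_prod !card_ffun !card_option card_ktype.
by rewrite !card_ord.
Qed.

Theorem theorem36 (phi : cmso2_sentence) :
  (exists g : nat -> nat,
     [/\ computable g,
         {homo g : m n / m <= n}
       & forall F : sgraph, models F phi -> tw F <= g (chi F)]) ->
  decidable_graph_rel (HomInd (fun F : sgraph => models F phi)).
Proof.
move=> [g [[pg Hg] gmono tw_le]].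
have rec_g : rec 1 (fun v => g (nth 0 v 0)).
  by exists pg => -[|n []] // _; apply: Hg.
pose nv v i := code_nth (nth 0 v i) 0.
pose B v := size_bound (sentence phi) (g (maxn (nv v 0) (nv v 1))).+1 (nv v 0) (nv v 1).
have rec_nv i : rec 2 (fun v => nv v i).
  by apply: rec_code_nth; [apply: rec_nth | apply: rec_const].
have [p Hp] : dec 2 (fun v => agree_upto (sentence phi) (B v) (nth 0 v 0) (nth 0 v 1)).
  apply: dec_agree_upto; try exact: rec_nth.
  apply: rec_size_bound => //; apply: rec_succ; apply: (rec_app1 rec_g).
  exact: rec_max.
exists p => G H; have := Hp [:: graph_code G; graph_code H] erefl.
rewrite /B /nv /= !code_nth0; set N := size_bound _ _ _ _.
suff agrP : agree_upto (sentence phi) N (graph_code G) (graph_code H) <->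
    HomInd (fun F : sgraph => models F phi) G H.
  case: agree_upto agrP => -[H1 H2] /= cp; split=> // nP.
    by case: nP; apply: H1.
  by have := H2 nP.
split=> [/agree_uptoP agr F FM|HI]; last by apply/agree_uptoP=> F _; apply: HI.
apply: contrapT => ne.
have chiF : chi F <= maxn #|G| #|H|.
  have [E|/chi_le le] := eqVneq (hom F G) 0; last by rewrite leq_max le.
  have /chi_le le : hom F H != 0 by apply/eqP=> E'; rewrite E E' in ne.
  by rewrite leq_max le orbT.
have twF : tw F <= g (maxn #|G| #|H|).
  by apply: leq_trans (tw_le F FM) _; apply: gmono.
have [F' [leF' FM' ne']] := bounded_counterexample twF FM ne.
by apply: ne'; apply: agr.
Qed.
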